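(* Let $P\in\mathrm{SpGr}(2n,2k)$ and $\Gamma\in T_P\mathrm{SpGr}(2n,2k)$. Furthermore, let $U\in\rho^{-1}(P)\subset\mathrm{SpSt}(2n,2k)$. The geodesic starting at $P$ in direction $\Gamma$ with respect to the pseudo-Riemannian metric $(\Gamma_1,\Gamma_2)\mapsto\mathrm{tr}(U^+\Gamma_1^+\Gamma_2U)$ on $\mathrm{SpGr}(2n,2k)$ is $$\mathrm{Exp}^{\mathrm{SpGr}}_P(t\Gamma):=\rho\big(\mathrm{Exp}^{\mathrm{SpSt},h}_U(t\Gamma^{\mathrm{hor}}_U)\big)=\exp(t[\Gamma,P])\,P\,\exp(-t[\Gamma,P]).$$
   Context: Let $k\le n$ be positive integers, $J_{2m}=\begin{bmatrix}0&I_m\\-I_m&0\end{bmatrix}$, and for a real $2a\times 2b$ matrix $A$ put $A^+:=J_{2b}^TA^TJ_{2a}$. $\mathfrak{sp}(2n,\mathbb{R})=\{\Omega\in\mathbb{R}^{2n\times2n}:\Omega^+=-\Omega\}$. $\mathrm{SpSt}(2n,2k)=\{U\in\mathbb{R}^{2n\times2k}:U^+U=I_{2k}\}$ with $T_U\mathrm{SpSt}(2n,2k)=\{\Delta: U^+\Delta\in\mathfrak{sp}(2k,\mathbb{R})\}$, and $\mathrm{SpGr}(2n,2k)=\{P\in\mathbb{R}^{2n\times2n}: P^2=P,\ \mathrm{rank}(P)=2k,\ P^+=P\}$ with $T_P\mathrm{SpGr}(2n,2k)=\{[\Omega,P]:\Omega\in\mathfrak{sp}(2n,\mathbb{R})\}$,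 where $[\cdot,\cdot]$ is the matrix commutator. $\rho:\mathrm{SpSt}(2n,2k)\to\mathrm{SpGr}(2n,2k)$, $\rho(U)=UU^+$. $\mathrm{SpSt}(2n,2k)$ carries the pseudo-Riemannian metric $h^{\mathrm{SpSt}}_U(\Delta_1,\Delta_2)=\mathrm{tr}\left(\Delta_1^+\left(I_{2n}-\frac12UU^+\right)\Delta_2\right)$ with geodesics $\mathrm{Exp}^{\mathrm{SpSt},h}_U(t\Delta)=\exp(t\tilde\Omega(U,\Delta))U$, $\tilde\Omega(U,\Delta)=(I_{2n}-\frac12UU^+)\Delta U^+-U\Delta^+(I_{2n}-\frac12UU^+)$. The horizontal lift of $\Gamma\in T_P\mathrm{SpGr}(2n,2k)$ to $U\in\rho^{-1}(P)$ (with respect to $\rho$ and $h^{\mathrm{SpSt}}$) is $\Gamma^{\mathrm{hor}}_U=\Gamma U$. The pseudo-Riemannian metric on $\mathrm{SpGr}(2n,2k)$ at $P$ is $(\Gamma_1,\Gamma_2)\mapsto h^{\mathrm{SpSt}}_U\big((\Gamma_1)^{\mathrm{hor}}_U,(\Gamma_2)^{\mathrm{hor}}_U\big)=\mathrm{tr}(U^+\Gamma_1^+\Gamma_2U)$ for any $U\in\rho^{-1}(P)$. $\exp$ is the matrix exponential. *)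

(* Defs.v *)
From HB Require Import structures.
From mathcomp Require Export all_boot all_order all_algebra.
From mathcomp Require Export all_classical all_reals all_analysis.
Export numFieldNormedType.Exports.

Set Implicit Arguments.
Unset Strict Implicit.
Unset Printing Implicit Defensive.

Import Order.TTheory GRing.Theory Num.Theory.
Local Open Scope classical_set_scope.
Local Open Scope ring_scope.

(* C^k on an open set [O].  In finite dimension, [f] is C^(k+1) iff it is
   differentiable and all its directional derivatives are C^k. *)
Fixpoint Ck_on (R : realType) (V W : normedModType R) (k : nat) (O : set V)
    (f : V -> W) : Prop :=
  if k is k'.+1 then
    (forall x, O x -> differentiable f x) /\
    (forall v, Ck_on k' O (fun x => 'D_v f x))
  else forall x, O x -> {for x, continuous f}.

Definition smooth_on (R : realType) (V W : normedModType R) (O : set V)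
    (f : V -> W) : Prop :=
  forall k, Ck_on k O f.

(* A submanifold of the finite-dimensional space [V] is given by its set of
   points [M] and its tangent spaces [T p], [p] in [M].  Functions and vector
   fields on [M] are total functions on [V], of which only the values on [M]
   matter; likewise for curves [R -> V] and their interval [I]. *)

(* [F] is a smooth extension of [f] from [M] to the neighbourhood [O] of [p]. *)
Definition local_extension (R : realType) (V W : normedModType R) (M : set V)
    (f : V -> W) (p : V) (O : set V) (F : V -> W) : Prop :=
  [/\ open O, O p, smooth_on O F & forall q, O q -> M q -> f q = F q].

Definition smooth_map (R : realType) (V W : normedModType R) (M : set V)
    (f : V -> W) : Prop :=
  forall p, M p -> exists O F, local_extension M f p O F.

(* Derivative at [p] in [M], in the tangent direction [v], of a smooth map [f]
   on [M]; it does not depend on the chosen extension. *)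
Definition tderive (R : realType) (V W : normedModType R) (M : set V)
    (f : V -> W) (p v : V) : W :=
  xget 0 [set w | exists O F, local_extension M f p O F /\ 'D_v F p = w].

Definition vector_field (R : realType) (V : normedModType R) (M : set V)
    (T : V -> set V) (X : V -> V) : Prop :=
  smooth_map M X /\ forall p, M p -> T p (X p).

(* Bracket [X, Y] of vector fields, in the coordinates of the ambient space. *)
Definition lie_bracket (R : realType) (V : normedModType R) (M : set V)
    (X Y : V -> V) (p : V) : V :=
  tderive M Y p (X p) - tderive M X p (Y p).

Record affine_connection (R : realType) (V : normedModType R) (M : set V)
    (T : V -> set V) (nabla : (V -> V) -> (V -> V) -> (V -> V)) : Prop := {
  connection_field : forall X Y,
    vector_field M T X -> vector_field M T Y -> vector_field M T (nabla X Y);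
  (* [nabla] only depends on the fields as fields on [M] *)
  connection_ext : forall X X' Y Y',
    vector_field M T X -> vector_field M T X' ->
    vector_field M T Y -> vector_field M T Y' ->
    (forall p, M p -> X p = X' p) -> (forall p, M p -> Y p = Y' p) ->
    forall p, M p -> nabla X Y p = nabla X' Y' p;
  connection_Dl : forall X X' Y,
    vector_field M T X -> vector_field M T X' -> vector_field M T Y ->
    forall p, M p ->
      nabla (fun q => X q + X' q) Y p = nabla X Y p + nabla X' Y p;
  connection_Zl : forall (f : V -> R^o) X Y,
    smooth_map M f -> vector_field M T X -> vector_field M T Y ->
    forall p, M p -> nabla (fun q => f q *: X q) Y p = f p *: nabla X Y p;
  connection_Dr : forall X Y Y',
    vector_field M T X -> vector_field M T Y -> vector_field M T Y' ->
    forall p, M p ->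
      nabla X (fun q => Y q + Y' q) p = nabla X Y p + nabla X Y' p;
  connection_leibniz : forall (f : V -> R^o) X Y,
    smooth_map M f -> vector_field M T X -> vector_field M T Y ->
    forall p, M p ->
      nabla X (fun q => f q *: Y q) p =
        tderive M f p (X p) *: Y p + f p *: nabla X Y p
}.

Record levi_civita (R : realType) (V : normedModType R) (M : set V)
    (T : V -> set V) (h : V -> V -> V -> R)
    (nabla : (V -> V) -> (V -> V) -> (V -> V)) : Prop := {
  levi_civita_connection : affine_connection M T nabla;
  levi_civita_torsion_free : forall X Y,
    vector_field M T X -> vector_field M T Y ->
    forall p, M p -> nabla X Y p - nabla Y X p = lie_bracket M X Y p;
  levi_civita_metric : forall X Y Z,
    vector_field M T X -> vector_field M T Y -> vector_field M T Z ->
    forall p, M p ->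
      tderive M (fun q => h q (Y q) (Z q) : R^o) p (X p) =
        h p (nabla X Y p) (Z p) + h p (Y p) (nabla X Z p)
}.

Definition smooth_curve (R : realType) (V : normedModType R) (M : set V)
    (I : set R) (g : R -> V) : Prop :=
  smooth_on (V := R^o) I g /\ forall t, I t -> M (g t).

Definition field_along (R : realType) (V : normedModType R) (T : V -> set V)
    (I : set R) (g : R -> V) (Z : R -> V) : Prop :=
  smooth_on (V := R^o) I Z /\ forall t, I t -> T (g t) (Z t).

(* [D] is the covariant derivative D/dt that the connection [nabla] induces on
   the vector fields along the curve [g]. *)
Record covariant_derivative_along (R : realType) (V : normedModType R)
    (M : set V) (T : V -> set V) (nabla : (V -> V) -> (V -> V) -> (V -> V))
    (I : set R) (g : R -> V) (D : (R -> V) -> (R -> V)) : Prop := {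
  covariant_field : forall Z, field_along T I g Z -> field_along T I g (D Z);
  covariant_ext : forall Z Z',
    field_along T I g Z -> field_along T I g Z' ->
    (forall t, I t -> Z t = Z' t) -> forall t, I t -> D Z t = D Z' t;
  covariant_D : forall Z Z', field_along T I g Z -> field_along T I g Z' ->
    forall t, I t -> D (fun s => Z s + Z' s) t = D Z t + D Z' t;
  covariant_leibniz : forall (f : R -> R^o) Z,
    smooth_on (V := R^o) I f -> field_along T I g Z ->
    forall t, I t ->
      D (fun s => f s *: Z s) t = derive1 f t *: Z t + f t *: D Z t;
  (* D (Y o g) / dt = nabla_(g') Y, where [X] is any field extending [g' t] *)
  covariant_restrict : forall X Y,
    vector_field M T X -> vector_field M T Y ->
    forall t, I t -> X (g t) = derive1 g t ->
      D (fun s => Y (g s)) t = nabla X Y (g t)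
}.

(* [g] is a geodesic of the pseudo-Riemannian manifold [(M, h)] on the open
   interval [I]: its velocity is parallel for the Levi-Civita connection.  Both
   [nabla] and [D] are unique as operators on fields on [M], resp. along [g]. *)
Definition is_geodesic (R : realType) (V : normedModType R) (M : set V)
    (T : V -> set V) (h : V -> V -> V -> R) (I : set R) (g : R -> V) : Prop :=
  [/\ open I, is_interval I, smooth_curve M I g, field_along T I g (derive1 g) &
      exists nabla D,
        [/\ levi_civita M T h nabla,
            covariant_derivative_along M T nabla I g D &
            forall t, I t -> D (derive1 g) t = 0]].

Definition mxcomm (R : realType) (m : nat) (A B : 'M[R]_m) : 'M[R]_m :=
  A *m B - B *m A.

Definition expm (R : realType) (m : nat) (A : 'M[R]_m) : 'M[R]_m :=
  limn (series (fun i : nat => (i`!%:R)^-1 *: A ^+ i)).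

(* A 2a x 2b matrix has type ['M_(a + a, b + b)], to fit the blocks of [Jmx]. *)

Definition Jmx (R : realType) (m : nat) : 'M[R]_(m + m) :=
  block_mx 0 1%:M (- 1%:M) 0.

Definition sympinv (R : realType) (a b : nat) (A : 'M[R]_(a + a, b + b)) :
    'M[R]_(b + b, a + a) :=
  (Jmx R b)^T *m A^T *m Jmx R a.

Definition sp (R : realType) (n : nat) : set 'M[R]_(n + n) :=
  [set Omega | sympinv Omega = - Omega].

Definition SpSt (R : realType) (n k : nat) : set 'M[R]_(n + n, k + k) :=
  [set U | sympinv U *m U = 1%:M].

Definition SpGr (R : realType) (n k : nat) : set 'M[R]_(n + n) :=
  [set P | [/\ P *m P = P, \rank P = (k + k)%N & sympinv P = P]].

Definition SpGr_tangent (R : realType) (n : nat) (P : 'M[R]_(n + n)) :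
    set 'M[R]_(n + n) :=
  [set mxcomm Omega P | Omega in @sp R n].

Definition rho (R : realType) (n k : nat) (U : 'M[R]_(n + n, k + k)) :
    'M[R]_(n + n) :=
  U *m sympinv U.

Definition Omega_tilde (R : realType) (n k : nat)
    (U Delta : 'M[R]_(n + n, k + k)) : 'M[R]_(n + n) :=
  (1%:M - 2^-1 *: (U *m sympinv U)) *m Delta *m sympinv U
  - U *m sympinv Delta *m (1%:M - 2^-1 *: (U *m sympinv U)).

(* [ExpSpSt U (t *: Delta) = exp (t *: Omega_tilde U Delta) *m U] is the geodesic
   from [U] in direction [Delta] for the metric
   h_U(D1, D2) = tr (D1^+ (I - U U^+ / 2) D2) on SpSt(2n, 2k). *)
Definition ExpSpSt (R : realType) (n k : nat) (U Delta : 'M[R]_(n + n, k + k)) :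
    'M[R]_(n + n, k + k) :=
  expm (Omega_tilde U Delta) *m U.

(* Horizontal lift to [U], with respect to [rho] and the same metric on SpSt. *)
Definition hor (R : realType) (n k : nat) (U : 'M[R]_(n + n, k + k))
    (Gamma : 'M[R]_(n + n)) : 'M[R]_(n + n, k + k) :=
  Gamma *m U.

(* The metric of SpGr(2n, 2k) at [P]; the value does not depend on the choice of
   [U] in the fibre of [rho] over [P]. *)
Definition SpGr_metric (R : realType) (n k : nat)
    (P Gamma1 Gamma2 : 'M[R]_(n + n)) : R :=
  let U := xget (0 : 'M[R]_(n + n, k + k)) [set U | SpSt U /\ rho U = P] in
  \tr (sympinv U *m sympinv Gamma1 *m Gamma2 *m U).

(* Main.v *)
Require Import Defs.
From mathcomp Require Import ring lra.
Import Order.TTheory GRing.Theory Num.Theory.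
Local Open Scope classical_set_scope.
Local Open Scope ring_scope.

(** Tangent vectors v of SpGr at p satisfy v^+ = v and v p + p v = v, so they exchange
the image and the kernel of p. On them the metric is half the trace form tr(v w)
of the ambient space of matrices ([SpGr_metricE]); this uses that every point of
SpGr has the form U U^+, which is symplectic Gram-Schmidt ([rho_surj]). SpGr is thus
a pseudo-Riemannian submanifold of a flat space: its Levi-Civita connection is the
ambient derivative followed by the orthogonal projection A |-> [[A, p], p] onto the
tangent space ([proj_connection_LC]), and a curve g is a geodesic exactly when
[[g'', g], g] = 0 ([geodesicP]).

Because a geodesic is defined through some Levi-Civita connection and some covariant
derivative, the equation needs the uniqueness of both. The difference of two
Levi-Civita connections is symmetric in two arguments and skew in two others, hence
pairs to zero with every vector field; the pairing is nondegenerate and the fields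
q |-> [W, q], with W in sp(2n), take every tangent vector as a value, so the
connections agree ([levi_civita_unique]). Finitely many of these fields span all the
tangent spaces at once; expanding a field along g over them, with smooth
coefficients, the axioms of a covariant derivative determine its value
([covariant_unique]).

The geodesic equation integrates explicitly. For a projection p, [[A, p], p] = 0
holds exactly when A commutes with p, so the equation says that W = [g', g] has zero
derivative. Since g' is tangent, g' = [[g', g], g] = [W, g] with W constant, and hence
g(t) = exp(tW) P exp(-tW) with W = [Gamma, P] ([geodesic_sp_orbit]). Conversely
W = [Gamma, P] exchanges image and kernel of every point of this curve, so
g'' = [W, [W, g]] commutes with g and the curve is a geodesic ([sp_orbit_geodesic]).
It is the projection of the geodesic of SpSt: with Gamma^+ = Gamma and
P Gamma P = 0, the generator Omega_tilde at the horizontal lift reduces to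
t [Gamma, P] ([Omega_tilde_hor]).

Derivatives of maps given on SpGr only are computed on any smooth extension. They do
not depend on it because a tangent vector [W, p] is the velocity of the curve
exp(tW) p exp(-tW), which stays in SpGr ([extension_derive_eq]). *)

Set Implicit Arguments.
Unset Strict Implicit.
Unset Printing Implicit Defensive.

(** * Additive normalization of matrix expressions *)

Lemma mx_addE (R : realType) m n (A B : 'M[R]_(m, n)) i j :
  (A + B) i j = A i j + B i j.
Proof. by rewrite mxE. Qed.

Lemma mx_oppE (R : realType) m n (A : 'M[R]_(m, n)) i j : (- A) i j = - A i j.
Proof. by rewrite mxE. Qed.

Lemma mx_scaleE (R : realType) m n a (A : 'M[R]_(m, n)) i j :
  (a *: A) i j = a * A i j.
Proof. by rewrite mxE. Qed.

Lemma mx_zeroE (R : realType) m n i j : (0 : 'M[R]_(m, n)) i j = 0.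
Proof. by rewrite mxE. Qed.

Definition mx_pwE := (mx_addE, mx_oppE, mx_scaleE, mx_zeroE).
Definition mx_distr := (mulmxDl, mulmxDr, mulmxBl, mulmxBr, mulmxN, mulNmx, mulmxA).

(** Matrix products do not commute, so [ring] does not apply to matrix identities. Once
products are distributed, only sums of words remain: read entrywise, the words
are atoms of a commutative ring. *)
Ltac mxabel := apply/matrixP => ? ?; rewrite !mx_pwE; ring.

(** * Functions of class C^k *)

(** A local expansion of [f] at [x] is one of [g]; uniqueness of the differential then
identifies the two differentials. *)
Lemma near_eq_differentiable (R : realType) (V W : normedModType R)
    (f g : V -> W) (x : V) :
  (\near x, f x = g x) -> differentiable f x -> differentiable g x.
Proof.
move=> fg df.
have fgx : f x = g x by exact: nbhs_singleton fg.
have dcf : continuous ('d f x) by exact: diff_continuous.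
have H : g \o shift x = cst (g x) + 'd f x +o_ 0 id.
  apply/eqaddoP => _ /posnumP[e].
  have /eqaddoP/(_ _ (gt0 e)) := diff_locally df.
  have fg0 : \forall y \near 0, f (y + x) = g (y + x).
    by move: fg; rewrite (near_shift 0 x) /= => fg; near=> y;
      rewrite -[x]subr0; near: y.
  by apply: filterS2 fg0 => y /= fgy; rewrite !fctE /= fgy fgx.
have dE := diff_unique dcf H.
by apply/diff_locallyP; rewrite dE; split.
Unshelve. all: by end_near. Qed.

(** The converse direction writes the map as the sum of its entries times the constant
elementary matrices. *)
Lemma differentiable_mxP (R : realType) (V : normedModType R) (m n : nat)
    (F : V -> 'M[R]_(m, n)) (x : V) :
  differentiable F x <-> forall i j, differentiable (fun y => F y i j : R^o) x.
Proof.
split=> [dF i j|dF].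
  apply: (@differentiable_comp _ _ _ _ F (fun N : 'M[R]_(m, n) => N i j : R^o)).
    exact: dF.
  exact: differentiable_coord.
have -> : F = \sum_i \sum_j (fun y => F y i j *: delta_mx i j).
  apply/funext => y; rewrite fct_sumE [LHS]matrix_sum_delta.
  by apply: eq_bigr => i _; rewrite fct_sumE.
apply: differentiable_sum => i; apply: differentiable_sum => j.
exact: (differentiableZl (k := fun y => F y i j)).
Qed.

Lemma cvg_mxP (R : realType) (T : Type) (m n : nat) (G : set_system T)
    (FG : Filter G) (F : T -> 'M[R]_(m, n)) (M : 'M[R]_(m, n)) :
  F x @[x --> G] --> M <-> forall i j, F x i j @[x --> G] --> (M i j : R^o).
Proof.
split=> [cF i j|cF].
  apply: (@cvg_comp _ _ _ F (fun N : 'M[R]_(m, n) => N i j : R^o) _ _ _ cF).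
  exact: coord_continuous.
apply/cvgrPdist_le => /= e e0; near=> x.
rewrite /Num.Def.normr/= mx_normrE (bigmax_le _ (ltW e0))//= => i _.
rewrite !mxE; move: i; near: x; apply: filter_forall => /= i.
exact: ((cvgrPdist_le _ _).1 (cF i.1 i.2)).
Unshelve. all: by end_near. Qed.

Section ClassCk.
Context {R : realType} {V : normedModType R}.
Implicit Types (O : set V) (k : nat).

(** Derivatives are local, so it suffices that the maps agree on the open set. *)
Lemma Ck_on_eq (W : normedModType R) k O (f g : V -> W) :
  open O -> (forall x, O x -> f x = g x) -> Ck_on k O f -> Ck_on k O g.
Proof.
elim: k f g => [|k IH] f g oO fg /= => [cf x Ox|[df dkf]].
  have nfg : {near x, f =1 g} by apply: filterS (open_nbhs_nbhs (conj oO Ox)).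
  rewrite /prop_for /continuous_at -fg//.
  by apply: cvg_trans (cf x Ox); exact: near_eq_cvg.
have nfg x : O x -> {near x, f =1 g}.
  by move=> Ox; apply: filterS (open_nbhs_nbhs (conj oO Ox)).
split=> [x Ox|v].
  by apply: near_eq_differentiable (df x Ox); exact: nfg.
by apply: IH (dkf v) => // x Ox; apply: near_eq_derive; exact: nfg.
Qed.

Lemma Ck_on_sub (W : normedModType R) k O O' (f : V -> W) :
  O' `<=` O -> Ck_on k O f -> Ck_on k O' f.
Proof.
move=> sO; elim: k f => [|k IH] f /= => [cf x /sO|[df dkf]]; first exact: cf.
by split=> [x /sO|v]; [exact: df|exact: IH].
Qed.

Lemma Ck_onS (W : normedModType R) k O (f : V -> W) :
  Ck_on k.+1 O f -> Ck_on k O f.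
Proof.
elim: k f => [|k IH] f [df dkf] => [x Ox|].
  by apply: differentiable_continuous; exact: df.
by split=> [//|v]; apply: IH; exact: dkf.
Qed.

Lemma Ck_on_cst (W : normedModType R) k O (c : W) : Ck_on k O (cst c).
Proof.
elim: k c => [|k IH] c /=; first by move=> x _; exact: cvg_cst.
split=> [x _|v]; first exact: differentiable_cst.
by rewrite (_ : (fun _ => _) = cst 0) //; apply/funext => x; exact: derive_cst.
Qed.

Lemma Ck_onD (W : normedModType R) k O (f g : V -> W) : open O ->
  Ck_on k O f -> Ck_on k O g -> Ck_on k O (fun x => f x + g x).
Proof.
move=> oO; elim: k f g => [|k IH] f g /= => [cf cg x Ox|[df dkf] [dg dkg]].
  by apply: cvgD; [exact: cf|exact: cg].
split=> [x Ox|v]; first by apply: differentiableD; [exact: df|exact: dg].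
apply: Ck_on_eq (IH _ _ (dkf v) (dkg v)) => // x Ox.
by rewrite deriveD //; apply: diff_derivable; [exact: df|exact: dg].
Qed.

Lemma Ck_onZ (W : normedModType R) k O (c : R) (f : V -> W) : open O ->
  Ck_on k O f -> Ck_on k O (fun x => c *: f x).
Proof.
move=> oO; elim: k f => [|k IH] f; first by
  move=> cf x Ox; exact: (continuousZl_tmp (cf x Ox)).
move=> [df ckf]; split=> [x Ox|v]; first by apply: differentiableZ; exact: df.
apply: Ck_on_eq (IH _ (ckf v)) => // x Ox.
by rewrite deriveZ//; apply: diff_derivable; exact: df.
Qed.

Lemma Ck_onM k O (f g : V -> R^o) : open O ->
  Ck_on k O f -> Ck_on k O g -> Ck_on k O (fun x => f x * g x : R^o).
Proof.
move=> oO; elim: k f g => [|k IH] f g.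
  by move=> cf cg x Ox; apply: (@continuousM R V f g x); [exact: cf|exact: cg].
move=> Cf Cg; have [df dkf] := Cf; have [dg dkg] := Cg.
split=> [x Ox|v]; first by apply: differentiableM; [exact: df|exact: dg].
apply: (@Ck_on_eq _ _ _ (fun x => f x * 'D_v g x + 'D_v f x * g x : R^o)) => //.
  move=> x Ox; rewrite (@deriveM _ _ f g).
  - by rewrite /GRing.scale /= [_ * g x]mulrC.
  - by apply: diff_derivable; exact: df.
  - by apply: diff_derivable; exact: dg.
by apply: Ck_onD => //; apply: IH;
  [exact: Ck_onS|exact: dkg|exact: dkf|exact: Ck_onS].
Qed.

Lemma Ck_on_sum k O (I : Type) (r : seq I) (W : normedModType R) (f : I -> V -> W) :
  open O -> (forall i, Ck_on k O (f i)) -> Ck_on k O (fun x => \sum_(i <- r) f i x).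
Proof.
move=> oO cf; elim: r => [|i r IH].
  by apply: Ck_on_eq (Ck_on_cst k O (0 : W)) => // x _; rewrite big_nil.
by apply: Ck_on_eq (Ck_onD oO (cf i) IH) => // x _; rewrite big_cons.
Qed.

(** Reduces the smoothness of matrix expressions to that of sums and products of scalar
functions. *)
Lemma Ck_on_mxP k O m n (F : V -> 'M[R]_(m, n)) : open O ->
  Ck_on k O F <-> forall i j, Ck_on k O (fun x => F x i j : R^o).
Proof.
move=> oO; elim: k F => [|k IH] F /=; split.
- by move=> cF i j x Ox; exact: ((cvg_mxP _ _ _).1 (cF x Ox)).
- by move=> cF x Ox; apply/cvg_mxP => i j; exact: cF.
- move=> [dF dkF] i j; split=> [x Ox|v].
    by move/differentiable_mxP: (dF x Ox).
  apply: Ck_on_eq (((IH _).1 (dkF v)) i j) => // x Ox.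
  by rewrite derive_mx ?mxE//; apply: diff_derivable; exact: dF.
- move=> cF; split=> [x Ox|v].
    by apply/differentiable_mxP => i j; have [+ _] := cF i j; exact.
  apply/IH => i j; have [_ /(_ v)] := cF i j.
  apply: Ck_on_eq => // x Ox; rewrite derive_mx ?mxE//.
  apply/derivable_mxP => a b; apply: diff_derivable.
  by have [+ _] := cF a b; exact.
Qed.

Lemma Ck_on_mulmx k O m n p (F : V -> 'M[R]_(m, n)) (G : V -> 'M[R]_(n, p)) :
  open O -> Ck_on k O F -> Ck_on k O G -> Ck_on k O (fun x => F x *m G x).
Proof.
move=> oO /(Ck_on_mxP _ _ oO) cF /(Ck_on_mxP _ _ oO) cG.
apply/(Ck_on_mxP _ _ oO) => i j.
have H : Ck_on k O (fun x => \sum_l (F x i l * G x l j) : R^o).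
  by apply: Ck_on_sum => // l; exact: Ck_onM.
by apply: Ck_on_eq H => // x _; rewrite mxE.
Qed.

Lemma Ck_on_scale k O m n (f : V -> R^o) (F : V -> 'M[R]_(m, n)) :
  open O -> Ck_on k O f -> Ck_on k O F -> Ck_on k O (fun x => f x *: F x).
Proof.
move=> oO cf /(Ck_on_mxP _ _ oO) cF; apply/(Ck_on_mxP _ _ oO) => i j.
by apply: Ck_on_eq (Ck_onM oO cf (cF i j)) => // x _; rewrite mxE.
Qed.

Lemma Ck_on_mxcomm k (O : set V) m (F G : V -> 'M[R]_m) : open O ->
  Ck_on k O F -> Ck_on k O G -> Ck_on k O (fun x => mxcomm (F x) (G x)).
Proof.
move=> oO cF cG; rewrite /mxcomm.
apply: Ck_onD => //; first exact: Ck_on_mulmx.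
apply: (@Ck_on_eq _ _ _ (fun x => - 1 *: (G x *m F x))) => //.
  by move=> x _; rewrite scaleN1r.
by apply: Ck_onZ => //; exact: Ck_on_mulmx.
Qed.

Lemma smooth_differentiable (W : normedModType R) (O : set V) (f : V -> W) x :
  smooth_on O f -> O x -> differentiable f x.
Proof. by move=> sf Ox; have [+ _] := sf 1%N; exact. Qed.

Lemma Ck_on_id k O : Ck_on k O (id : V -> V).
Proof.
case: k => [x _|k]; first exact: cvg_id.
split=> [x _|v]; first exact: ex_diff.
rewrite (_ : (fun _ => _) = cst v); first exact: Ck_on_cst.
by apply/funext => x; exact: derive_id.
Qed.

End ClassCk.

(** * Derivatives of matrix-valued maps *)

Section Derivatives.
Context {R : realType} {V : normedModType R}.
Implicit Types (x v : V).

Lemma is_derive_mxP m n (F : V -> 'M[R]_(m, n)) x v (dF : 'M[R]_(m, n)) :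
  is_derive x v F dF <->
  forall i j, is_derive x v (fun y => F y i j : R^o) (dF i j).
Proof.
split=> [[dv <-] i j|d].
  rewrite derive_mx// mxE; apply: DeriveDef => //.
  exact: (derivable_mxP _ _ _).1.
have dv : derivable F x v by apply/derivable_mxP => i j; have [] := d i j.
apply: DeriveDef => //; rewrite derive_mx//.
by apply/matrixP => i j; rewrite mxE; have [_ ->] := d i j.
Qed.

Lemma is_derive_bigsum (I : Type) (r : seq I) (W : normedModType R)
    (f : I -> V -> W) x v (df : I -> W) :
  (forall i, is_derive x v (f i) (df i)) ->
  is_derive x v (fun y => \sum_(i <- r) f i y) (\sum_(i <- r) df i).
Proof.
move=> fd; elim: r => [|i r IH].
  rewrite big_nil (_ : (fun _ => _) = cst 0); last first.
    by apply/funext => y; rewrite big_nil.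
  exact: is_derive_cst.
rewrite big_cons (_ : (fun _ => _) = f i + (fun y => \sum_(i <- r) f i y)).
  exact: is_deriveD.
by apply/funext => y; rewrite big_cons.
Qed.

Lemma is_derive_mulmx m n p (F : V -> 'M[R]_(m, n)) (G : V -> 'M[R]_(n, p))
    x v dF dG : is_derive x v F dF -> is_derive x v G dG ->
  is_derive x v (fun y => F y *m G y) (dF *m G x + F x *m dG).
Proof.
move=> /is_derive_mxP dFe /is_derive_mxP dGe; apply/is_derive_mxP => i j.
rewrite (_ : (fun _ => _) =
    (fun y => \sum_l (F y i l * G y l j) : R^o)); last first.
  by apply/funext => y; rewrite mxE.
rewrite !mxE -big_split/=; apply: is_derive_bigsum => l.
have := @is_deriveM _ _ (fun y => F y i l) (fun y => G y l j) x v _ _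
  (dFe i l) (dGe l j).
by move=> H; apply: is_derive_eq H _; rewrite /GRing.scale/=; ring.
Qed.

Lemma is_derive_trmx m n (F : V -> 'M[R]_(m, n)) x v dF :
  is_derive x v F dF -> is_derive x v (fun y => (F y)^T) dF^T.
Proof.
move=> /is_derive_mxP dFe; apply/is_derive_mxP => i j; rewrite mxE.
by rewrite (_ : (fun _ => _) = (fun y => F y j i : R^o))//;
  apply/funext => y; rewrite mxE.
Qed.

Lemma is_derive_mxtrace n (F : V -> 'M[R]_n) x v dF :
  is_derive x v F dF -> is_derive x v (fun y => \tr (F y) : R^o) (\tr dF).
Proof. by move=> /is_derive_mxP dFe; exact: is_derive_bigsum. Qed.

Lemma is_derive_scale m n (f : V -> R^o) (F : V -> 'M[R]_(m, n)) x v df dF :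
  is_derive x v f df -> is_derive x v F dF ->
  is_derive x v (fun y => f y *: F y) (df *: F x + f x *: dF).
Proof.
move=> fd /is_derive_mxP dFe; apply/is_derive_mxP => i j.
rewrite (_ : (fun _ => _) = (fun y => f y * F y i j : R^o)); last first.
  by apply/funext => y; rewrite mxE.
have := @is_deriveM _ _ f (fun y => F y i j) x v _ _ fd (dFe i j).
by move=> H; apply: is_derive_eq H _; rewrite !mxE /GRing.scale/=; ring.
Qed.

Lemma is_derive_sympinv a b (F : V -> 'M[R]_(a + a, b + b)) x v dF :
  is_derive x v F dF -> is_derive x v (fun y => sympinv (F y)) (sympinv dF).
Proof.
move=> /is_derive_trmx dFt.
have H1 := is_derive_mulmx (is_derive_cst (Jmx R b)^T x v) dFt.
have := is_derive_mulmx H1 (is_derive_cst (Jmx R a) x v).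
by move=> H; apply: is_derive_eq H _; rewrite mulmx0 addr0 mul0mx add0r.
Qed.

Lemma is_derive_diff (W : normedModType R) (f : V -> W) x v :
  differentiable f x -> is_derive x v f ('D_v f x).
Proof. by move=> df; apply: derivableP; exact: diff_derivable. Qed.

(** Chain rule along a curve; it trades a directional derivative at [g t] for an
ordinary derivative, which sees the values of [f] on the curve only. *)
Lemma is_derive_curve (W : normedModType R) (f : V -> W) (g : R -> V) (t : R) v :
  is_derive t 1 g v -> differentiable f (g t) ->
  is_derive t 1 (f \o g) ('D_v f (g t)).
Proof.
move=> [dg gv] df; have dg' : differentiable g t by exact/derivable1_diffP.
have dfg : differentiable (f \o g) t by exact: differentiable_comp.
apply: DeriveDef; first exact/derivable1_diffP.
by rewrite deriveE// diff_comp// -gv !deriveE.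
Qed.

Lemma derive_linear (W : normedModType R) (f : V -> W) x :
  differentiable f x -> linear (fun v => 'D_v f x).
Proof. by move=> df a u v; rewrite !deriveE// linearP. Qed.

Lemma derive_dirZ (W : normedModType R) (f : V -> W) x a v :
  differentiable f x -> 'D_(a *: v) f x = a *: 'D_v f x.
Proof.
by move=> df; have := derive_linear df a v 0; rewrite !addr0 derive0 addr0.
Qed.

Lemma derive_dir_sum (I : Type) (r : seq I) (W : normedModType R)
    (f : V -> W) x (e : I -> V) : differentiable f x ->
  'D_(\sum_(i <- r) e i) f x = \sum_(i <- r) 'D_(e i) f x.
Proof.
move=> df; elim: r => [|i r IH]; first by rewrite !big_nil derive0.
rewrite !big_cons -IH.
by have := derive_linear df 1 (e i) (\sum_(i <- r) e i); rewrite !scale1r.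
Qed.

Lemma is_derive_mxcomm m (F G : V -> 'M[R]_m) x v dF dG :
  is_derive x v F dF -> is_derive x v G dG ->
  is_derive x v (fun y => mxcomm (F y) (G y)) (mxcomm dF (G x) + mxcomm (F x) dG).
Proof.
move=> hF hG.
have := is_deriveB (is_derive_mulmx hF hG) (is_derive_mulmx hG hF).
by move=> h; apply: is_derive_eq h _; rewrite /mxcomm; mxabel.
Qed.

End Derivatives.

Lemma smooth_sympinv (R : realType) (V : normedModType R) (a b : nat) (O : set V)
    (F : V -> 'M[R]_(a + a, b + b)) : open O ->
  smooth_on O F -> smooth_on O (fun q => sympinv (F q)).
Proof.
move=> oO sF i; rewrite /sympinv; apply: Ck_on_mulmx => //; last exact: Ck_on_cst.
apply: Ck_on_mulmx => //; first exact: Ck_on_cst.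
apply/Ck_on_mxP => // c d; have /(Ck_on_mxP _ _ oO)/(_ d c) := sF i.
by apply: Ck_on_eq => // x _; rewrite mxE.
Qed.

Lemma smooth_mxtrace (R : realType) (V : normedModType R) (m : nat) (O : set V)
    (F : V -> 'M[R]_m) : open O ->
  smooth_on O F -> smooth_on O (fun q => \tr (F q) : R^o).
Proof.
move=> oO sF i; apply: Ck_on_sum => // a.
by have /(Ck_on_mxP _ _ oO) := sF i.
Qed.

(** The direction varies with the point; by linearity in the direction the derivative is
a combination of the derivatives along the elementary matrices, whose coefficients
are the entries of [G]. *)
Lemma Ck_on_derive_along (R : realType) m n p q k
    (O : set 'M[R]_(m, n)) (F : 'M[R]_(m, n) -> 'M[R]_(p, q))
    (G : 'M[R]_(m, n) -> 'M[R]_(m, n)) : open O ->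
  smooth_on O F -> Ck_on k O G -> Ck_on k O (fun x => 'D_(G x) F x).
Proof.
move=> oO sF /(Ck_on_mxP _ _ oO) cG.
have dF x : O x -> differentiable F x by have [+ _] := sF 1%N; exact.
apply: (@Ck_on_eq _ _ _ _ _
  (fun x => \sum_i \sum_j G x i j *: 'D_(delta_mx i j) F x)) => //.
  move=> x /dF dFx; rewrite [in RHS](matrix_sum_delta (G x)) derive_dir_sum//.
  apply: eq_bigr => i _; rewrite derive_dir_sum//.
  by apply: eq_bigr => j _; rewrite derive_dirZ.
apply: Ck_on_sum => // i; apply: Ck_on_sum => // j; apply: Ck_on_scale => //.
by have [_] := sF k.+1; exact.
Qed.

(** Mean value theorem, entry by entry. Conserved quantities of the
geodesic equation are recognized through it. *)
Lemma is_derive0_mx_cst (R : realType) m n (I : set R) (F : R -> 'M[R]_(m, n)) :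
  is_interval I -> (forall t, I t -> is_derive t 1 F 0) ->
  forall s t, I s -> I t -> F s = F t.
Proof.
move=> iI dF.
suff le s t : s <= t -> I s -> I t -> F s = F t.
  by move=> s t Is It; have [/le->//|/ltW/le->] := leP s t.
move=> st Is It; apply/matrixP => i j.
have Ist u : s <= u <= t -> I u by exact: iI.
have d u : s <= u <= t -> is_derive u 1 (fun y => F y i j : R) 0.
  by move=> /Ist /dF /is_derive_mxP/(_ i j); rewrite mxE.
have [||c _] := @MVT_segment R (fun y => F y i j) (cst 0) s t st.
- by move=> u; rewrite in_itv/= => /andP[/ltW su /ltW ut]; apply: d; rewrite su ut.
- apply: derivable_within_continuous => u; rewrite in_itv/= => ust.
  by have [] := d u ust.
by rewrite mul0r => /eqP; rewrite subr_eq0 => /eqP.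
Qed.

Section Curves.
Context {R : realType} {W : normedModType R}.
Implicit Types (I : set R) (f : R -> W).

(** For curves the direction 1 suffices, the derivative along [v] being [v] times it. *)
Lemma CkS_curve k I f : open I ->
  (forall t, I t -> derivable f t 1) -> Ck_on (V := R^o) k I (derive1 f) ->
  Ck_on (V := R^o) k.+1 I f.
Proof.
move=> oI df ckf; split=> [t It|v]; first by apply/derivable1_diffP; exact: df.
have vE t : I t -> v *: derive1 f t = 'D_v (f : R^o -> W) t.
  move=> It; rewrite derive1E -derive_dirZ; first by rewrite /GRing.scale/= mulr1.
  by apply/derivable1_diffP; exact: df.
apply: (@Ck_on_eq _ _ _ _ _ (fun t => v *: derive1 f t)) => //.
exact: Ck_onZ.
Qed.

Lemma Ck_derive1 k I f : Ck_on (V := R^o) k.+1 I f ->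
  Ck_on (V := R^o) k I (derive1 f).
Proof.
move=> [_ /(_ 1)]; congr Ck_on.
by apply/funext => t; rewrite derive1E.
Qed.

Lemma smooth_is_derive I f t : smooth_on (V := R^o) I f -> I t ->
  is_derive t 1 f (derive1 f t).
Proof.
move=> sf It; rewrite derive1E; apply: derivableP.
by apply/derivable1_diffP; have [+ _] := sf 1%N; exact.
Qed.

End Curves.

(** * The symplectic inverse *)

Section SymplecticInverse.
Context {R : realType}.

Lemma Jmx_tr n : (Jmx R n)^T = - Jmx R n.
Proof.
rewrite /Jmx tr_block_mx !linear0 linearN/= trmx1 opp_block_mx.
by rewrite oppr0 opprK.
Qed.

Lemma mulJT n : Jmx R n *m (Jmx R n)^T = 1%:M.
Proof.
rewrite Jmx_tr mulmxN /Jmx mulmx_block !mul0mx !mulmx0 !mul1mx !mulmx1.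
by rewrite !(addr0, add0r) opp_block_mx opprK oppr0 -scalar_mx_block.
Qed.

Lemma mulTJ n : (Jmx R n)^T *m Jmx R n = 1%:M.
Proof. exact/mulmx1C/mulJT. Qed.

Lemma sympinvM a b c (A : 'M[R]_(a + a, b + b)) (B : 'M[R]_(b + b, c + c)) :
  sympinv (A *m B) = sympinv B *m sympinv A.
Proof.
rewrite /sympinv trmx_mul !mulmxA -[X in _ = X *m _ *m _]mulmxA.
by rewrite -[X in _ = X *m _ *m _]mulmxA mulJT mulmx1.
Qed.

Lemma sympinvK a b (A : 'M[R]_(a + a, b + b)) : sympinv (sympinv A) = A.
Proof.
have JJ c : Jmx R c *m Jmx R c = - 1%:M.
  by rewrite -[RHS]opprK -(mulJT c) Jmx_tr mulmxN !opprK.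
rewrite /sympinv !trmx_mul !trmxK !Jmx_tr !(mulNmx, mulmxN, opprK) !mulmxA.
by rewrite JJ !mulNmx mul1mx -mulmxA JJ mulmxN mulmx1 opprK.
Qed.

Lemma sympinvD a b (A B : 'M[R]_(a + a, b + b)) :
  sympinv (A + B) = sympinv A + sympinv B.
Proof. by rewrite /sympinv linearD/= mulmxDr mulmxDl. Qed.

Lemma sympinvN a b (A : 'M[R]_(a + a, b + b)) : sympinv (- A) = - sympinv A.
Proof. by rewrite /sympinv linearN/= mulmxN mulNmx. Qed.

Lemma sympinvB a b (A B : 'M[R]_(a + a, b + b)) :
  sympinv (A - B) = sympinv A - sympinv B.
Proof. by rewrite sympinvD sympinvN. Qed.

Lemma sympinvZ a b x (A : 'M[R]_(a + a, b + b)) :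
  sympinv (x *: A) = x *: sympinv A.
Proof. by rewrite /sympinv linearZ/= -scalemxAr -scalemxAl. Qed.

Lemma sympinv1 a : sympinv (1%:M : 'M[R]_(a + a)) = 1%:M.
Proof. by rewrite /sympinv trmx1 mulmx1 mulTJ. Qed.

Lemma mxtrace_sympinv a (A : 'M[R]_(a + a)) : \tr (sympinv A) = \tr A.
Proof. by rewrite /sympinv mxtrace_mulC mulmxA mulJT mul1mx mxtrace_tr. Qed.

Lemma sympinv_mxcomm n (A B : 'M[R]_(n + n)) :
  sympinv (mxcomm A B) = mxcomm (sympinv B) (sympinv A).
Proof. by rewrite sympinvB !sympinvM. Qed.

(** The columns of [U] form a symplectic basis: their Gram matrix for the symplectic form
is the standard one. *)
Lemma SpStE n k (U : 'M[R]_(n + n, k + k)) :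
  SpSt U <-> U^T *m Jmx R n *m U = Jmx R k.
Proof.
rewrite /SpSt/= /sympinv; split=> [h|h].
  by rewrite -[RHS]mulmx1 -h !mulmxA mulJT mul1mx.
by rewrite -mulmxA -mulmxA [U^T *m _]mulmxA h mulTJ.
Qed.

End SymplecticInverse.

(** * Tangent spaces of the symplectic Grassmannian *)

Section Grassmannian.
Context {R : realType} {n k : nat}.
Implicit Types (p v w A B : 'M[R]_(n + n)).

Lemma idem_r p : p *m p = p -> forall m (x : 'M[R]_(m, _)), x *m p *m p = x *m p.
Proof. by move=> pp m x; rewrite -mulmxA pp. Qed.

(** The orthogonal projection onto the tangent space at [p], for the trace form: with
respect to the image and kernel of [p] it keeps the two off-diagonal blocks of [A]. *)
Definition tproj p A := mxcomm (mxcomm A p) p.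

Lemma tprojE p A : p *m p = p ->
  tproj p A = A *m p + p *m A - 2 *: (p *m A *m p).
Proof.
move=> pp; rewrite /tproj /mxcomm !mx_distr pp (idem_r pp); mxabel.
Qed.

(** Multiply v p + p v = v by p on the left. *)
Lemma tangent_corner0 p v : p *m p = p -> v *m p + p *m v = v -> p *m v *m p = 0.
Proof.
move=> pp vp.
have : p *m v = p *m v *m p + p *m v by rewrite -[in LHS]vp !mx_distr pp.
by move/eqP; rewrite -[X in X == _]add0r (inj_eq (addIr _)) => /eqP.
Qed.

Lemma tproj_id p v : p *m p = p -> v *m p + p *m v = v -> tproj p v = v.
Proof.
by move=> pp vp; rewrite tprojE// (tangent_corner0 pp vp) scaler0 subr0.
Qed.

Lemma sp_mxcomm p A : sympinv p = p -> sympinv A = A -> sp (mxcomm A p).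
Proof. by move=> ps As; rewrite /sp/= sympinv_mxcomm ps As /mxcomm opprB. Qed.

(** Converting the tangent space from a parametrized to an implicit form. In the backward
direction [v, p] is an element of sp that generates [v], since [[v, p], p] = v. *)
Lemma tangentP p v : @SpGr R n k p ->
  SpGr_tangent p v <-> sympinv v = v /\ v *m p + p *m v = v.
Proof.
move=> [pp _ ps]; split=> [[W hW <-]|[vs vp]].
  split; first by rewrite sympinv_mxcomm ps hW /mxcomm !mx_distr; mxabel.
  by rewrite /mxcomm !mx_distr pp (idem_r pp); mxabel.
by exists (mxcomm v p); [exact: sp_mxcomm|exact: tproj_id].
Qed.

Lemma tproj_tangent p A : @SpGr R n k p -> sympinv A = A ->
  SpGr_tangent p (tproj p A).
Proof. by move=> [_ _ ps] As; exists (mxcomm A p) => //; exact: sp_mxcomm. Qed.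

Lemma tproj_comm0 p A : p *m p = p -> A *m p = p *m A -> tproj p A = 0.
Proof. by move=> pp Ap; rewrite /tproj /mxcomm Ap subrr mul0mx mulmx0 subrr. Qed.

Lemma tprojD p A B : tproj p (A + B) = tproj p A + tproj p B.
Proof. by rewrite /tproj /mxcomm !mx_distr; mxabel. Qed.

Lemma mxcommZl p a A : mxcomm (a *: A) p = a *: mxcomm A p.
Proof. by rewrite /mxcomm -scalemxAl -scalemxAr scalerBr. Qed.

Lemma tprojZ p a A : tproj p (a *: A) = a *: tproj p A.
Proof. by rewrite /tproj !mxcommZl. Qed.

Lemma tprojB p A B : tproj p (A - B) = tproj p A - tproj p B.
Proof. by rewrite tprojD -[- B]scaleN1r tprojZ scaleN1r. Qed.

Lemma tangent_id p v : @SpGr R n k p -> SpGr_tangent p v -> tproj p v = v.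
Proof.
by move=> hp tv; have [pp _ _] := hp; have [_ vp] := (tangentP _ hp).1 tv;
  exact: tproj_id.
Qed.

Lemma tangentD p v w : SpGr_tangent p v -> SpGr_tangent p w ->
  SpGr_tangent p (v + w).
Proof.
move=> [A hA <-] [B hB <-]; exists (A + B).
  by rewrite /sp/= sympinvD hA hB opprD.
by rewrite /mxcomm !mx_distr; mxabel.
Qed.

Lemma tangentZ p a v : SpGr_tangent p v -> SpGr_tangent p (a *: v).
Proof.
move=> [A hA <-]; exists (a *: A).
  by rewrite /sp/= sympinvZ hA scalerN.
by rewrite /mxcomm -scalemxAl -scalemxAr scalerBr.
Qed.

Lemma tangentB p v w : SpGr_tangent p v -> SpGr_tangent p w ->
  SpGr_tangent p (v - w).
Proof.
by move=> tv tw; rewrite -scaleN1r; apply: tangentD => //; exact: tangentZ.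
Qed.

(** [A] and [B] stand for the derivatives of two tangent fields, [y] and [x], along each
other. Differentiating v p + p v = v adds a term to the tangency equation, which is
the same for both: a Lie bracket of tangent fields is tangent. *)
Lemma tangent_eq_sub p A B x y :
  B *m p + p *m B + (x *m y + y *m x) = B ->
  A *m p + p *m A + (y *m x + x *m y) = A ->
  (A - B) *m p + p *m (A - B) = A - B.
Proof.
by move=> eB eA; rewrite -[in RHS]eA -[in RHS]eB mulmxBl mulmxBr; mxabel.
Qed.

Lemma tangent_mxcomm_anti p v : @SpGr R n k p -> SpGr_tangent p v ->
  let W := mxcomm v p in sp W /\ W *m p + p *m W = W.
Proof.
move=> hp tv /=; have [pp _ ps] := hp; have [vs _] := (tangentP _ hp).1 tv.
split; first exact: sp_mxcomm.
by rewrite /mxcomm !mx_distr pp (idem_r pp); mxabel.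
Qed.

(** [W] exchanges image and kernel of [p], so its square preserves both. *)
Lemma mxcomm_mxcomm_comm p W : p *m p = p -> W *m p + p *m W = W ->
  mxcomm W (mxcomm W p) *m p = p *m mxcomm W (mxcomm W p).
Proof.
move=> pp Wp; have pWp := tangent_corner0 pp Wp.
have WWp : W *m W *m p = p *m W *m W.
  have e1 : W *m p *m W + W *m W *m p = W *m W.
    by have := congr1 (mulmx W) Wp; rewrite mulmxDr !mulmxA addrC.
  have e2 : W *m p *m W + p *m W *m W = W *m W.
    by have := congr1 (mulmxr W) Wp; rewrite /= mulmxDl.
  by apply: (addrI (W *m p *m W)); rewrite e1 e2.
have z1 : W *m p *m W *m p = 0 by rewrite -!mulmxA (mulmxA p) pWp mulmx0.
have z2 : p *m W *m p *m W = 0 by rewrite pWp mul0mx.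
by rewrite /mxcomm !mx_distr pp (idem_r pp) z1 z2 WWp; mxabel.
Qed.

(** The off-diagonal blocks of [A] vanish. *)
Lemma tproj_eq0_comm p A : p *m p = p -> tproj p A = 0 -> A *m p = p *m A.
Proof.
move=> pp; rewrite tprojE// => /eqP; rewrite subr_eq0 => /eqP e.
have pA : p *m A = p *m A *m p.
  have := congr1 (mulmx p) e; rewrite mulmxDr -scalemxAr !mulmxA pp => e'.
  by apply: (addrI (p *m A *m p)); rewrite e' scaler_nat mulr2n.
have Ap : A *m p = p *m A *m p.
  have := congr1 (mulmxr p) e; rewrite /= mulmxDl -scalemxAl (idem_r pp) => e'.
  by apply: (addIr (p *m A *m p)); rewrite e' (idem_r pp) scaler_nat mulr2n.
by rewrite Ap -pA.
Qed.

End Grassmannian.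

(** * Symplectic Gram-Schmidt and the metric *)

Lemma gram_row_mx (R : realType) (m a b c d : nat) (J : 'M[R]_m)
    (A1 : 'M[R]_(m, a)) (A2 : 'M[R]_(m, b))
    (B1 : 'M[R]_(m, c)) (B2 : 'M[R]_(m, d)) :
  (row_mx A1 A2)^T *m J *m (row_mx B1 B2) =
  block_mx (A1^T *m J *m B1) (A1^T *m J *m B2)
           (A2^T *m J *m B1) (A2^T *m J *m B2).
Proof. by rewrite tr_row_mx mul_col_mx mul_col_mx !mul_mx_row. Qed.

Section Grassmannian.
Context {R : realType} {n k : nat}.
Implicit Types (p v w A B : 'M[R]_(n + n)).

(** Symplectic Gram-Schmidt. As long as the frame [U] is too small, the complementary
projection D = p - U U^+ is nonzero and self-adjoint, so the symplectic form is
nondegenerate on its image: some pair x, y there with form 1 extends the frame. *)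
Lemma symplectic_frame p j : @SpGr R n k p -> (j <= k)%N ->
  exists U : 'M[R]_(n + n, j + j), SpSt U /\ p *m U = U.
Proof.
move=> [pp prk ps]; elim: j => [_|j IH jk].
  by exists 0; split; [rewrite /SpSt/= mulmx0; apply/matrixP => -[]|rewrite mulmx0].
have [U [hU pU]] := IH (ltnW jk).
pose Q := U *m sympinv U.
have Us : sympinv U *m p = sympinv U by rewrite -[X in _ *m X]ps -sympinvM pU.
have Qs : sympinv Q = Q by rewrite /Q sympinvM sympinvK.
have pQ : p *m Q = Q by rewrite /Q mulmxA pU.
have Qp : Q *m p = Q by rewrite /Q -mulmxA Us.
have QQ : Q *m Q = Q by rewrite /Q -mulmxA [sympinv U *m _]mulmxA hU mul1mx.
pose D := p - Q.
have Ds : sympinv D = D by rewrite sympinvB ps Qs.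
have DD : D *m D = D by rewrite /D mulmxBl !mulmxBr pp QQ pQ Qp; mxabel.
have UD : sympinv U *m D = 0.
  by rewrite /D mulmxBr Us /Q mulmxA hU mul1mx subrr.
have pD : p *m D = D by rewrite /D mulmxBr pp pQ.
have DJ : D^T *m Jmx R n = Jmx R n *m D.
  by rewrite -[D in RHS]Ds /sympinv !mulmxA mulJT mul1mx.
have /eqP D0 : D != 0.
  apply: contraTneq jk; rewrite -leqNgt => /eqP; rewrite subr_eq0 => /eqP pE.
  have : (\rank p <= j + j)%N.
    by rewrite pE; exact: leq_trans (mxrankM_maxl _ _) (rank_leq_col _).
  by rewrite prk; rewrite !addnn leq_double.
have [c [i xi]] : exists c i, (D *m delta_mx c (0 : 'I_1)) i 0 != 0.
  apply/not_existsP => h; apply: D0; apply/matrixP => i c; rewrite [RHS]mxE.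
  have := h c => /forallNP/(_ i)/negP/negPn/eqP <-.
  rewrite [RHS]mxE (bigD1 c)//= big1 ?addr0.
    by rewrite [delta_mx _ _ _ _]mxE !eqxx mulr1.
  by move=> l lc; rewrite [delta_mx _ _ _ _]mxE (negbTE lc) mulr0.
set x := D *m delta_mx c 0 in xi.
have Dx : D *m x = x by rewrite /x mulmxA DD.
(* J^T e_i pairs with x to the nonzero entry x_i; projecting by D does not change the
   pairing, as D is self-adjoint, and dividing by x_i normalizes it to 1 *)
pose y := (x i 0)^-1 *: (D *m ((Jmx R n)^T *m delta_mx i (0 : 'I_1))).
have Dy : D *m y = y by rewrite /y -scalemxAr (mulmxA D D) DD.
clearbody x.
have xJD : x^T *m Jmx R n *m D = x^T *m Jmx R n.
  by rewrite -mulmxA -DJ mulmxA -trmx_mul Dx.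
have xJy : x^T *m Jmx R n *m y = 1%:M.
  rewrite /y -scalemxAr (mulmxA _ D) xJD -(mulmxA x^T)
    (mulmxA (Jmx R n)) mulJT mul1mx.
  apply/matrixP => a b; rewrite !ord1 mxE mxE (bigD1 i)//= big1.
    by rewrite !mxE !eqxx addr0 mulr1 mulVf.
  by move=> l li; rewrite [delta_mx _ _ _ _]mxE (negbTE li) mulr0.
have alt0 (z : 'cV[R]_(n + n)) : z^T *m Jmx R n *m z = 0.
  apply/matrixP => a b; rewrite !ord1 [RHS]mxE; set e := z^T *m _ *m z.
  have /matrixP/(_ 0 0) : e^T = - e.
    by rewrite /e !trmx_mul trmxK Jmx_tr mulNmx mulmxN mulmxA.
  by rewrite !mxE => h; lra.
have anti m1 m2 (A1 : 'M[R]_(_, m1)) (A2 : 'M[R]_(_, m2)) :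
    A2^T *m Jmx R n *m A1 = - (A1^T *m Jmx R n *m A2)^T.
  by rewrite !trmx_mul trmxK Jmx_tr mulNmx mulmxN mulmxA opprK.
have UJ (z : 'cV[R]_(n + n)) : D *m z = z -> U^T *m Jmx R n *m z = 0.
  move=> zD; have : sympinv U *m z = 0 by rewrite -zD mulmxA UD mul0mx.
  rewrite /sympinv => /(congr1 (mulmx (Jmx R j))).
  by rewrite mulmx0 !mulmxA mulJT mul1mx.
pose E := lsubmx U; pose F := rsubmx U.
have UE : U = row_mx E F by rewrite /E /F hsubmxK.
have EFJ (z : 'cV[R]_(n + n)) : D *m z = z ->
    E^T *m Jmx R n *m z = 0 /\ F^T *m Jmx R n *m z = 0.
  move=> /UJ; rewrite {1}UE tr_row_mx !mul_col_mx -col_mx0.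
  by move/eq_col_mx.
have [Ex Fx] := EFJ _ Dx; have [Ey Fy] := EFJ _ Dy.
have [EE EF FE FF] : [/\ E^T *m Jmx R n *m E = 0, E^T *m Jmx R n *m F = 1%:M,
     F^T *m Jmx R n *m E = - 1%:M & F^T *m Jmx R n *m F = 0].
  by move/SpStE: hU; rewrite UE gram_row_mx => /eq_block_mx.
rewrite -[j.+1]addn1.
exists (row_mx (row_mx E x) (row_mx F y)); split; last first.
  have px : p *m x = x by rewrite -Dx mulmxA pD.
  have py : p *m y = y by rewrite -Dy mulmxA pD.
  move: pU; rewrite UE mul_mx_row => /eq_row_mx[pE pF].
  by rewrite !mul_mx_row pE pF px py.
apply/SpStE; rewrite !gram_row_mx.
rewrite EE EF FE FF Ex Ey Fx Fy !alt0 xJy.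
(* antisymmetry of the form gives the pairings in the opposite order *)
rewrite (anti _ _ E x) (anti _ _ F x) (anti _ _ E y) (anti _ _ F y) (anti _ _ x y).
rewrite Ex Ey Fx Fy xJy !linear0 trmx1.
rewrite /Jmx [1%:M in RHS]scalar_mx_block opp_block_mx oppr0.
by rewrite !block_mx0 oppr0.
Qed.

(** A full symplectic frame of the image of [p] gives a projection below [p] of the same
rank. *)
Lemma rho_surj p : @SpGr R n k p ->
  exists U : 'M[R]_(n + n, k + k), SpSt U /\ rho U = p.
Proof.
move=> hp; have [U [hU pU]] := symplectic_frame hp (leqnn k).
have [pp prk ps] := hp.
exists U; split=> //; rewrite /rho.
set Q := U *m _.
have Us : sympinv U *m p = sympinv U by rewrite -[X in _ *m X]ps -sympinvM pU.
have Qp : Q *m p = Q by rewrite /Q -mulmxA Us.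
have pQ : p *m Q = Q by rewrite /Q mulmxA pU.
have QQ : Q *m Q = Q by rewrite /Q -mulmxA [sympinv U *m _]mulmxA hU mul1mx.
have rQ : (k + k <= \rank Q)%N.
  have : \rank (sympinv U *m Q *m U) = (k + k)%N.
    by rewrite /Q mulmxA hU mul1mx hU mxrank1.
  by move=> <-; exact: leq_trans (mxrankM_maxl _ _) (mxrankM_maxr _ _).
have Qp' : (Q <= p)%MS by apply/submxP; exists Q.
have [_ rE] := mxrank_leqif_sup Qp'.
have : (p <= Q)%MS by rewrite -rE eqn_leq mxrankS// prk.
by move=> /submxP[X pX]; rewrite -pQ pX -mulmxA QQ.
Qed.

(** The metric is tr(p v w), and tr(v w) = tr(v p w) + tr(p v w) by tangency. The two
summands are equal, since ^+ preserves traces and reverses products, and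
the trace is cyclic. *)
Lemma SpGr_metricE p v w : @SpGr R n k p ->
  SpGr_tangent p v -> SpGr_tangent p w ->
  @SpGr_metric R n k p v w = 2^-1 * \tr (v *m w).
Proof.
move=> hp /(tangentP _ hp)[vs vp] /(tangentP _ hp)[ws wp].
have [_ _ ps] := hp.
rewrite /SpGr_metric; case: xgetP => [U _ [_ rU]|none]; last first.
  by have [U hU] := rho_surj hp; have := none U; rewrite /= => /(_ hU).
rewrite mxtrace_mulC mulmxA (mulmxA U) -/(rho U) rU vs.
have pvw : \tr (p *m v *m w) = \tr (v *m p *m w).
  rewrite mxtrace_mulC mulmxA -mxtrace_sympinv !sympinvM ps vs ws.
  by rewrite mulmxA.
have : \tr (v *m w) = \tr (v *m p *m w) + \tr (p *m v *m w).
  by rewrite -mxtraceD -mulmxDl vp.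
by rewrite pvw => ->; lra.
Qed.

Lemma mxtrace_mul_eq0 m (v : 'M[R]_m) :
  (forall B : 'M[R]_m, \tr (v *m B) = 0) -> v = 0.
Proof.
move=> vB; apply/matrixP => i j; rewrite [RHS]mxE.
have := vB (delta_mx j i); rewrite /mxtrace (bigD1 i)//= big1 ?addr0.
  rewrite mxE (bigD1 j)//= big1 ?addr0; first by rewrite mxE !eqxx mulr1.
  by move=> l lj; rewrite mxE (negbTE lj) mulr0.
move=> l li; rewrite mxE big1// => a _.
by rewrite mxE (negbTE li) andbF mulr0.
Qed.

(** [tproj p] drops the diagonal blocks of [A], which pair to zero with tangent vectors
since p v p = 0. *)
Lemma mxtrace_tprojr p v A : @SpGr R n k p -> SpGr_tangent p v ->
  \tr (v *m tproj p A) = \tr (v *m A).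
Proof.
move=> hp tv; have [pp _ _] := hp; have [vs vp] := (tangentP _ hp).1 tv.
rewrite tprojE// mulmxBr mulmxDr linearB/= mxtraceD -scalemxAr mxtraceZ.
rewrite !mulmxA [\tr (v *m A *m p)]mxtrace_mulC mulmxA.
rewrite [\tr (v *m p *m A *m p)]mxtrace_mulC !mulmxA.
rewrite (tangent_corner0 pp vp) mul0mx linear0 mulr0 subr0.
by rewrite -mxtraceD -mulmxDl [p *m v + _]addrC vp.
Qed.

(** The trace form is nondegenerate on all matrices; testing against [B] amounts to
testing against the projection of B + B^+, which is tangent. *)
Lemma metric_nondegenerate p v : @SpGr R n k p -> SpGr_tangent p v ->
  (forall w, SpGr_tangent p w -> @SpGr_metric R n k p v w = 0) -> v = 0.
Proof.
move=> hp tv h; apply: mxtrace_mul_eq0 => B.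
have [vs _] := (tangentP _ hp).1 tv.
pose A := B + sympinv B.
have As : sympinv A = A by rewrite /A sympinvD sympinvK addrC.
have := h _ (tproj_tangent hp As).
rewrite SpGr_metricE//; last exact: (tproj_tangent hp As).
rewrite mxtrace_tprojr// /A mulmxDr mxtraceD.
have -> : \tr (v *m sympinv B) = \tr (v *m B).
  by rewrite -[in LHS]vs -sympinvM mxtrace_sympinv mxtrace_mulC.
by lra.
Qed.

End Grassmannian.

(** * The matrix exponential and one-parameter orbits *)

Section MatrixExponential.
Context {R : realType} {m : nat}.
Implicit Types (A B : 'M[R]_m) (t : R).

Definition expm_term A : nat -> 'M[R]_m := fun i => (i`!%:R)^-1 *: A ^+ i.

(** Entry (a, b) of the i-th Taylor coefficient at 0 of the j-th derivative of exp(tA).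
Carrying j makes the family stable under termwise differentiation. *)
Definition expm_coef A a b j : R^nat := fun i => (i`!%:R)^-1 * (A ^+ (i + j)) a b.

Lemma entry_expr_le A a b i : `|(A ^+ i) a b| <= (m%:R * `|A|) ^+ i.
Proof.
elim: i a b => [|i IH] a b.
  by rewrite !expr0 mxE; case: (a == b); rewrite /= ?normr1 ?normr0.
rewrite exprS [(A * _) a b]mxE (le_trans (ler_norm_sum _ _ _))//.
have bnd l : `|A a l * (A ^+ i) l b| <= `|A| * (m%:R * `|A|) ^+ i.
  rewrite normrM ler_pM//.
  by rewrite [leRHS]/Num.Def.normr/= mx_normrE; exact: (le_bigmax _ _ (a, l)).
rewrite (le_trans (ler_sum _ (fun l _ => bnd l)))//.
by rewrite sumr_const card_ord [leRHS]exprS -[leRHS]mulrA [leRHS]mulr_natl.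
Qed.

(** Dominated by the exponential series, through the bound (m |A|)^i on the entries of
A^i. *)
Lemma cvg_expm_coef A a b j t : cvgn (pseries (expm_coef A a b j) t).
Proof.
apply: normed_cvg.
pose K := m%:R * `|A|.
have K0 : 0 <= K by rewrite mulr_ge0.
apply: (@series_le_cvg _ _ (fun i => K ^+ j * exp_coeff (K * `|t|) i)).
- by move=> i /=.
- by move=> i; rewrite mulr_ge0 ?exprn_ge0// exp_coeff_ge0// mulr_ge0.
- move=> i /=; rewrite /expm_coef /exp_coeff/= !normrM normrX.
  rewrite (ger0_norm (_ : 0 <= (i`!%:R)^-1)); last by rewrite invr_ge0.
  have -> : K ^+ j * ((K * `|t|) ^+ i / i`!%:R) =
      (i`!%:R)^-1 * K ^+ (i + j) * `|t| ^+ i.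
    by rewrite [(K * _) ^+ i]exprMn [K ^+ (i + j)]exprD; ring.
  rewrite ler_wpM2r ?exprn_ge0// ler_wpM2l ?invr_ge0//.
  exact: entry_expr_le.
- apply: is_cvg_seriesZ; exact: is_cvg_series_exp_coeff.
Qed.

Lemma pseries_diffs_expm_coef A a b j :
  pseries_diffs (expm_coef A a b j) = expm_coef A a b j.+1.
Proof.
apply/funext => i; rewrite /pseries_diffs /expm_coef factS natrM invfM addSnnS.
by rewrite !mulrA divff ?pnatr_eq0// mul1r.
Qed.

Lemma series_mxE (u : nat -> 'M[R]_m) n a b :
  series u n a b = series (fun i => u i a b) n.
Proof. by rewrite /series/= summxE. Qed.

Lemma exprZmx A t i : (t *: A) ^+ i = t ^+ i *: A ^+ i.
Proof.
elim: i => [|i IH]; first by rewrite !expr0 scale1r.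
rewrite !exprS IH -[LHS]/((t *: A) *m (t ^+ i *: A ^+ i)).
by rewrite -scalemxAl -scalemxAr scalerA.
Qed.

Lemma expm_termZ A t a b :
  (fun i => expm_term (t *: A) i a b) =
  (fun i => expm_coef A a b 0 i * t ^+ i).
Proof.
apply/funext => i; rewrite /expm_term /expm_coef addn0 exprZmx !mxE; ring.
Qed.

Lemma cvg_expm A : series (expm_term A) @ \oo --> expm A.
Proof.
suff : cvgn (series (expm_term A)) by [].
pose L : 'M[R]_m := \matrix_(a, b) limn (pseries (expm_coef A a b 0) 1).
apply/cvg_ex; exists L; apply/cvg_mxP => a b; rewrite mxE.
have := @cvg_expm_coef A a b 0 1.
rewrite /pseries -expm_termZ scale1r => h.
by under eq_fun do rewrite series_mxE.
Qed.

Lemma expm_entry A t a b :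
  expm (t *: A) a b = limn (pseries (expm_coef A a b 0) t).
Proof.
apply/esym/cvg_lim => //; rewrite /pseries -expm_termZ.
have /cvg_mxP/(_ a b) := @cvg_expm (t *: A).
by under eq_fun do rewrite series_mxE.
Qed.

Lemma cvg_mulmx (T : Type) (F : set_system T) {FF : Filter F} p q
    (f : T -> 'M[R]_(p, m)) (g : T -> 'M[R]_(m, q))
    (M : 'M[R]_(p, m)) (N : 'M[R]_(m, q)) :
  f x @[x --> F] --> M -> g x @[x --> F] --> N ->
  f x *m g x @[x --> F] --> M *m N.
Proof.
move=> /cvg_mxP cf /cvg_mxP cg; apply/cvg_mxP => i j.
rewrite mxE; under eq_fun do rewrite mxE.
apply: cvg_big => [|l _]; last exact: cvgM (cf i l) (cg l j).
exact: add_continuous.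
Qed.

Lemma expm_comm A B : B *m A = A *m B -> B *m expm A = expm A *m B.
Proof.
move=> BA; have cE := @cvg_expm A.
have h1 : B *m series (expm_term A) n @[n --> \oo] --> B *m expm A.
  by apply: cvg_mulmx => //; exact: cvg_cst.
have h2 : series (expm_term A) n *m B @[n --> \oo] --> expm A *m B.
  by apply: cvg_mulmx => //; exact: cvg_cst.
rewrite -(cvg_lim _ h1)// -(cvg_lim _ h2)//; congr (lim (_ @ \oo)).
apply/funext => n; rewrite /series/= mulmx_sumr mulmx_suml.
apply: eq_bigr => i _; rewrite /expm_term -scalemxAl -scalemxAr; congr (_ *: _).
exact: (commrX i (BA : GRing.comm B A)).
Qed.

(** Termwise differentiation of the power series of each entry. *)
Lemma is_derive_expm A t :
  is_derive t 1 (fun s => expm (s *: A)) (A *m expm (t *: A)).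
Proof.
apply/is_derive_mxP => a b.
have -> : (fun s => expm (s *: A) a b) =
    (fun s => limn (pseries (expm_coef A a b 0) s)).
  by apply/funext => s; rewrite expm_entry.
have -> : (A *m expm (t *: A)) a b =
    limn (pseries (pseries_diffs (expm_coef A a b 0)) t).
  apply/esym/cvg_lim => //.
  have -> : pseries (pseries_diffs (expm_coef A a b 0)) t =
      fun n => (A *m series (expm_term (t *: A)) n) a b.
    apply/funext => n.
    rewrite /series/= mulmx_sumr summxE /pseries /series/=; apply: eq_bigr => i _.
    rewrite pseries_diffs_expm_coef /expm_term /expm_coef addn1 exprS exprZmx.
    by rewrite -!scalemxAr !mx_scaleE; ring.
  have : A *m series (expm_term (t *: A)) n @[n --> \oo] --> A *m expm (t *: A).
    by apply: cvg_mulmx; [exact: cvg_cst|exact: cvg_expm].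
  by move=> /cvg_mxP/(_ a b).
apply: (@pseries_snd_diffs _ _ (`|t| + 1)); rewrite ?pseries_diffs_expm_coef.
- exact: cvg_expm_coef.
- exact: cvg_expm_coef.
- exact: cvg_expm_coef.
- by rewrite [ltRHS]ger0_norm ?ltrDl// addr_ge0.
Qed.

Lemma expm0 : expm 0 = 1%:M :> 'M[R]_m.
Proof.
have E n : series (expm_term 0) n.+1 = 1%:M.
  rewrite /series/= big_nat_recl//= /expm_term expr0 invr1 scale1r.
  by rewrite big1 ?addr0// => i _; rewrite expr0n/= scaler0.
apply/cvg_lim => //; rewrite -(cvg_shiftS (series (expm_term 0))).
by under eq_fun do rewrite E; exact: cvg_cst.
Qed.

(** The derivative of exp(-tA) exp(tA) is zero. *)
Lemma expmN_mul A : expm (- A) *m expm A = 1%:M.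
Proof.
pose f s := expm (s *: - A) *m expm (s *: A).
have df (s : R) : is_derive s 1 f 0.
  have := is_derive_mulmx (is_derive_expm (- A) s) (is_derive_expm A s).
  move=> h; apply: is_derive_eq h _.
  rewrite mulmxA -[expm _ *m A]expm_comm; last first.
    by rewrite scalerN !(mulmxN, mulNmx) -scalemxAl -scalemxAr.
  by rewrite mulNmx mulNmx addNr.
have := @is_derive0_mx_cst _ _ _ setT f.
move=> /(_ _ (fun t _ => df t) 1 0 I I).
rewrite /f !scale1r !scale0r expm0 mulmx1; apply.
by move=> ? ? ? ? ? ?.
Qed.

Lemma Ck_on_expm A k : Ck_on (V := R^o) k setT (fun s => expm (s *: A)).
Proof.
elim: k => [|k IH].
  move=> t _; apply: differentiable_continuous; apply/derivable1_diffP.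
  by have [] := is_derive_expm A t.
apply: CkS_curve; first exact: openT.
  by move=> t _; have [] := is_derive_expm A t.
have -> : derive1 (fun s => expm (s *: A)) = fun s => A *m expm (s *: A).
  by apply/funext => s; rewrite derive1E; have [_ ->] := is_derive_expm A s.
by apply: Ck_on_mulmx => //; [exact: openT|exact: Ck_on_cst].
Qed.

End MatrixExponential.

Lemma sympinv_expm (R : realType) n (A : 'M[R]_(n + n)) :
  sympinv (expm A) = expm (sympinv A).
Proof.
have cE := @cvg_expm _ _ A.
have ct : (series (expm_term A) n)^T @[n --> \oo] --> (expm A)^T.
  move/cvg_mxP : cE => cE; apply/cvg_mxP => i j; rewrite mxE.
  by under eq_fun do rewrite mxE; exact: cE.
have c : (Jmx R n)^T *m (series (expm_term A) N)^T *m Jmx R n @[N --> \oo] -->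
    sympinv (expm A).
  apply: cvg_mulmx; last exact: cvg_cst.
  by apply: cvg_mulmx ct; exact: cvg_cst.
rewrite -(cvg_lim _ c)// /expm; congr (lim (_ @ \oo)).
apply/funext => N; rewrite -/(sympinv _).
have sX i : sympinv (A ^+ i) = sympinv A ^+ i.
  elim: i => [|i IH]; first exact: sympinv1.
  by rewrite exprS exprSr sympinvM IH.
rewrite /series/=; elim/big_rec2: _ => [|i x y _ <-].
  by rewrite /sympinv trmx0 mulmx0 mul0mx.
by rewrite sympinvD sympinvZ sX.
Qed.

Section Orbits.
Context {R : realType} {n : nat}.
Implicit Types (p W : 'M[R]_(n + n)) (t : R).

(** The orbit of [p] under conjugation by the one-parameter group generated by [W]. For
[W] in sp this is a curve in SpGr with velocity [W, p] at p. *)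
Definition sp_orbit W p t := expm (t *: W) *m p *m expm (- t *: W).

Lemma sp_orbit0 W p : sp_orbit W p 0 = p.
Proof. by rewrite /sp_orbit oppr0 !scale0r expm0 mul1mx mulmx1. Qed.

Lemma expmV_r W t : expm (t *: W) *m expm (- t *: W) = 1%:M.
Proof. by apply: mulmx1C; rewrite scaleNr expmN_mul. Qed.

Lemma expmV_l W t : expm (- t *: W) *m expm (t *: W) = 1%:M.
Proof. by rewrite scaleNr expmN_mul. Qed.

Lemma expm_commZ W t : W *m expm (t *: W) = expm (t *: W) *m W.
Proof. by apply: expm_comm; rewrite -scalemxAl -scalemxAr. Qed.

Lemma is_derive_expmN W t :
  is_derive t 1 (fun s => expm (- s *: W)) (- (W *m expm (- t *: W))).
Proof.
have -> : (fun s => expm (- s *: W)) = (fun s => expm (s *: - W)).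
  by apply/funext => s; rewrite scaleNr scalerN.
by rewrite scaleNr -scalerN -mulNmx; exact: is_derive_expm.
Qed.

Lemma is_derive_sp_orbit W p t :
  is_derive t 1 (sp_orbit W p) (mxcomm W (sp_orbit W p t)).
Proof.
have h1 := is_derive_mulmx (is_derive_expm W t) (is_derive_cst p t 1).
have := is_derive_mulmx h1 (is_derive_expmN W t).
move=> h; apply: is_derive_eq h _.
rewrite /mxcomm /sp_orbit mulmx0 addr0 !mulmxA mulmxN.
by rewrite (expm_commZ W (- t)) !mulmxA.
Qed.

Lemma smooth_sp_orbit W p : smooth_on (V := R^o) setT (sp_orbit W p).
Proof.
move=> k; have oT := @openT R^o.
apply: Ck_on_mulmx => //.
  by apply: Ck_on_mulmx => //; [exact: Ck_on_expm|exact: Ck_on_cst].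
apply: Ck_on_eq (Ck_on_expm (- W) k) => // s _.
by rewrite scaleNr scalerN.
Qed.

Lemma sp_orbit_SpGr k W p t : sp W -> @SpGr R n k p -> @SpGr R n k (sp_orbit W p t).
Proof.
move=> hW [pp prk ps].
have EE := expmV_l W t; have EE' := expmV_r W t.
split.
- rewrite /sp_orbit !mulmxA -(mulmxA (_ *m p)) EE mulmx1.
  by rewrite -(mulmxA _ p p) pp.
- have uE : expm (t *: W) \in unitmx by case/mulmx1_unit: EE'.
  have uE' : expm (- t *: W) \in unitmx by case/mulmx1_unit: EE'.
  rewrite /sp_orbit mxrankMfree; last by rewrite row_free_unit.
  by rewrite -mxrank_tr trmx_mul mxrankMfree ?mxrank_tr// row_free_unit unitmx_tr.
- rewrite /sp_orbit !sympinvM !sympinv_expm !sympinvZ hW ps mulmxA.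
  by rewrite !scalerN scaleNr opprK.
Qed.

End Orbits.

(** * Differentiating maps known on the Grassmannian only *)

Section TangentDerivative.
Context {R : realType} {n k : nat}.
Local Notation Mat := 'M[R]_(n + n).
Local Notation M := (@SpGr R n k).
Local Notation T := (@SpGr_tangent R n).
Implicit Types (p v : Mat).

(** A tangent vector [A, p] is the velocity of the curve [sp_orbit A p], which lies in
SpGr; the two extensions agree along it. *)
Lemma extension_derive_eq (W : normedModType R) (f : Mat -> W) p v O F O' F' :
  M p -> T p v -> local_extension M f p O F -> local_extension M f p O' F' ->
  'D_v F p = 'D_v F' p.
Proof.
move=> Mp [A hA <-] [oO Op sF fF] [oO' Op' sF' fF'].
pose c := sp_orbit A p.
have dc : is_derive (0 : R) 1 c (mxcomm A p).
  by have := is_derive_sp_orbit A p 0; rewrite sp_orbit0.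
have c0 : c 0 = p by exact: sp_orbit0.
have dF : differentiable F (c 0) by rewrite c0; exact: smooth_differentiable Op.
have dF' : differentiable F' (c 0) by rewrite c0; exact: smooth_differentiable Op'.
have [_] := is_derive_curve dc dF'; rewrite c0 => <-.
have [_] := is_derive_curve dc dF; rewrite c0 => <-.
apply: near_eq_derive.
have cc : c @ (0 : R) --> p.
  rewrite -[X in _ --> X]c0; apply: differentiable_continuous.
  apply/derivable1_diffP.
  by case: dc.
have n1 : \forall t \near (0 : R), O (c t) by apply: cc; exact: open_nbhs_nbhs.
have n2 : \forall t \near (0 : R), O' (c t) by apply: cc; exact: open_nbhs_nbhs.
near=> t; rewrite /= -fF ?fF'//; try by near: t.
all: by apply: sp_orbit_SpGr.
Unshelve. all: by end_near. Qed.

Lemma tderiveE (W : normedModType R) (f : Mat -> W) p v O F :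
  M p -> T p v -> local_extension M f p O F -> tderive M f p v = 'D_v F p.
Proof.
move=> Mp Tv eF; rewrite /tderive; case: xgetP => [w _ [Ow [Fw [eFw <-]]]|no].
  exact: extension_derive_eq eFw eF.
by have := no ('D_v F p); case; exists O, F.
Qed.

Lemma local_extension_at (W : normedModType R) (f : Mat -> W) p O F q :
  local_extension M f p O F -> O q -> local_extension M f q O F.
Proof. by case. Qed.

Lemma local_extension_cap (W W' : normedModType R) (f : Mat -> W) (f' : Mat -> W')
    p O F O' F' :
  local_extension M f p O F -> local_extension M f' p O' F' ->
  [/\ open (O `&` O'), (O `&` O') p,
      local_extension M f p (O `&` O') F & local_extension M f' p (O `&` O') F'].
Proof.
move=> [oO Op sF fF] [oO' Op' sF' fF'].
have oI : open (O `&` O') by exact: openI.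
split=> //; split=> //.
- by move=> i; apply: Ck_on_sub (sF i) => x [].
- by move=> q [] + _; exact: fF.
- by move=> i; apply: Ck_on_sub (sF' i) => x [].
- by move=> q [] _; exact: fF'.
Qed.

Lemma local_extension_Ck (W : normedModType R) (f : Mat -> W) p O F :
  local_extension M f p O F -> forall q, O q -> differentiable F q.
Proof. by move=> [_ _ sF _] q Oq; exact: smooth_differentiable Oq. Qed.

(** Both equations come from the independence of the extension: if [F] extends a tangent
field [Y], then so do q |-> (F q)^+ and q |-> F q q + q F q, because the values of [Y] are
tangent. *)
Lemma tderive_field Y p v : vector_field M T Y -> M p -> T p v ->
  let A := tderive M Y p v in
  sympinv A = A /\ A *m p + p *m A + (Y p *m v + v *m Y p) = A.
Proof.
move=> [sY tY] Mp Tv /=; have [ O [F eF]] := sY p Mp.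
have [oO Op sF fF] := eF.
have dF := is_derive_diff v (local_extension_Ck eF Op).
rewrite (tderiveE Mp Tv eF); split.
  have eF' : local_extension M Y p O (fun q => sympinv (F q)).
    split=> //; first exact: smooth_sympinv.
    by move=> q Oq Mq; rewrite -fF//; have [-> _] := (tangentP _ Mq).1 (tY q Mq).
  rewrite [RHS](extension_derive_eq Mp Tv eF eF').
  by have [_ ->] := is_derive_sympinv dF.
(* differentiating this extension produces the tangency defect *)
have eF' : local_extension M Y p O (fun q => F q *m q + q *m F q).
  split=> //.
    by move=> i; apply: Ck_onD => //; apply: Ck_on_mulmx => //; exact: Ck_on_id.
  by move=> q Oq Mq; rewrite -fF//; have [_ ->] := (tangentP _ Mq).1 (tY q Mq).
rewrite [RHS](extension_derive_eq Mp Tv eF eF').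
have di := is_derive_id p v.
have [_ ->] := is_deriveD (is_derive_mulmx dF di) (is_derive_mulmx di dF).
by rewrite -fF//; mxabel.
Qed.

End TangentDerivative.

(** * The Levi-Civita connection *)

Section LeviCivita.
Context {R : realType} {n k : nat}.
Local Notation Mat := 'M[R]_(n + n).
Local Notation M := (@SpGr R n k).
Local Notation T := (@SpGr_tangent R n).
Local Notation h := (@SpGr_metric R n k).
Implicit Types (p v : Mat) (X Y Z : Mat -> Mat).

Definition proj_connection X Y p : Mat := tproj p (tderive M Y p (X p)).

Lemma vector_field_tangent X p : vector_field M T X -> M p -> T p (X p).
Proof. by move=> [_]; exact. Qed.

Lemma proj_connection_field X Y :
  vector_field M T X -> vector_field M T Y ->
  vector_field M T (proj_connection X Y).
Proof.
move=> fX fY; split=> [p Mp|p Mp]; last first.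
  apply: (tproj_tangent Mp).
  exact: (proj1 (tderive_field fY Mp (vector_field_tangent fX Mp))).
have [[sX _] [sY _]] := (fX, fY).
have [OX [FX eX]] := sX p Mp; have [OY [FY eY]] := sY p Mp.
have [oO Op eX' eY'] := local_extension_cap eX eY.
exists (OX `&` OY), (fun q => tproj q ('D_(FX q) FY q)); split=> //.
  have [_ _ sFX _] := eX'; have [_ _ sFY _] := eY'.
  move=> i; rewrite /tproj; have si := @Ck_on_id _ _ i (OX `&` OY).
  apply: (Ck_on_mxcomm oO _ si); apply: (Ck_on_mxcomm oO _ si).
  exact: (Ck_on_derive_along oO sFY (sFX i)).
move=> q Oq Mq; rewrite /proj_connection.
rewrite (tderiveE Mq (vector_field_tangent fX Mq) (local_extension_at eY' Oq)).
by have [_ _ _ ->] := eX'.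
Qed.

Lemma tderive_ext (W : normedModType R) (f g : Mat -> W) p v :
  smooth_map M f -> (forall q, M q -> f q = g q) -> M p -> T p v ->
  tderive M f p v = tderive M g p v.
Proof.
move=> sf fg Mp Tv; have [ O [F eF]] := sf p Mp.
rewrite (tderiveE Mp Tv eF) (tderiveE (O := O) (F := F))//.
by have [oO Op sF fF] := eF; split=> // q Oq Mq; rewrite -fg//; exact: fF.
Qed.

Lemma tderive_dirD (W : normedModType R) (f : Mat -> W) p v w :
  smooth_map M f -> M p -> T p v -> T p w ->
  tderive M f p (v + w) = tderive M f p v + tderive M f p w.
Proof.
move=> sf Mp Tv Tw; have [ O [F eF]] := sf p Mp.
have [_ Op _ _] := eF.
rewrite !(tderiveE (O := O) (F := F))//; last exact: tangentD.
have := derive_linear (local_extension_Ck eF Op) 1 v w.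
by rewrite !scale1r.
Qed.

Lemma tderive_dirZ (W : normedModType R) (f : Mat -> W) p a v :
  smooth_map M f -> M p -> T p v ->
  tderive M f p (a *: v) = a *: tderive M f p v.
Proof.
move=> sf Mp Tv; have [ O [F eF]] := sf p Mp.
have [_ Op _ _] := eF.
rewrite !(tderiveE (O := O) (F := F))//; last exact: tangentZ.
by rewrite derive_dirZ//; exact: local_extension_Ck eF _ Op.
Qed.

Lemma tderiveD (W : normedModType R) (f g : Mat -> W) p v :
  smooth_map M f -> smooth_map M g -> M p -> T p v ->
  tderive M (fun q => f q + g q) p v = tderive M f p v + tderive M g p v.
Proof.
move=> sf sg Mp Tv; have [OF [F eF]] := sf p Mp; have [OG [G eG]] := sg p Mp.
have [oO Op eF' eG'] := local_extension_cap eF eG.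
rewrite (tderiveE Mp Tv eF') (tderiveE Mp Tv eG').
rewrite (tderiveE (O := OF `&` OG) (F := F + G))//.
  by rewrite deriveD//; apply: diff_derivable;
    [exact: local_extension_Ck eF' _ Op|exact: local_extension_Ck eG' _ Op].
have [_ _ sF fF] := eF'; have [_ _ sG fG] := eG'.
split=> //; first by move=> i; exact: Ck_onD.
by move=> q Oq Mq; rewrite fF// fG.
Qed.

Lemma tderive_scale (f : Mat -> R^o) Y p v :
  smooth_map M f -> smooth_map M Y -> M p -> T p v ->
  tderive M (fun q => f q *: Y q) p v =
  tderive M f p v *: Y p + f p *: tderive M Y p v.
Proof.
move=> sf sg Mp Tv; have [OF [F eF]] := sf p Mp; have [OG [G eG]] := sg p Mp.
have [oO Op eF' eG'] := local_extension_cap eF eG.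
rewrite (tderiveE Mp Tv eF') (tderiveE Mp Tv eG').
have [_ _ sF fF] := eF'; have [_ _ sG fG] := eG'.
rewrite (tderiveE (O := OF `&` OG) (F := fun q => F q *: G q))//.
  have dF := is_derive_diff v (local_extension_Ck eF' Op).
  have dG := is_derive_diff v (local_extension_Ck eG' Op).
  by have [_ ->] := is_derive_scale dF dG; rewrite fF// fG.
split=> //; first by move=> i; exact: Ck_on_scale.
by move=> q Oq Mq; rewrite fF// fG.
Qed.

Lemma tderive_metric Y Z p v :
  vector_field M T Y -> vector_field M T Z -> M p -> T p v ->
  tderive M (fun q => h q (Y q) (Z q) : R^o) p v =
  2^-1 * (\tr (tderive M Y p v *m Z p) + \tr (Y p *m tderive M Z p v)).
Proof.
move=> fY fZ Mp Tv; have [[sY _] [sZ _]] := (fY, fZ).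
have [OF [F eF]] := sY p Mp; have [OG [G eG]] := sZ p Mp.
have [oO Op eF' eG'] := local_extension_cap eF eG.
rewrite (tderiveE Mp Tv eF') (tderiveE Mp Tv eG').
have [_ _ sF fF] := eF'; have [_ _ sG fG] := eG'.
rewrite (tderiveE (O := OF `&` OG) 
  (F := fun q => 2^-1 *: (\tr (F q *m G q)) : R^o))//.
  have dF := is_derive_diff v (local_extension_Ck eF' Op).
  have dG := is_derive_diff v (local_extension_Ck eG' Op).
  have [dt tE] := is_derive_mxtrace (is_derive_mulmx dF dG).
  by rewrite deriveZ// tE mxtraceD fF// fG.
split=> //.
  move=> i; apply: Ck_onZ => //; apply: smooth_mxtrace => // j.
  exact: Ck_on_mulmx.
move=> q Oq Mq; rewrite SpGr_metricE// ?fF ?fG//.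
  by rewrite -fF//; exact: vector_field_tangent.
by rewrite -fG//; exact: vector_field_tangent.
Qed.

(** Linearity and the Leibniz rule pass through the projection, which fixes tangent
vectors. Torsion-freeness holds because Lie brackets are tangent, and metricity
because the trace form is constant and the projection orthogonal. *)
Lemma proj_connection_LC : levi_civita M T h proj_connection.
Proof.
split; first split.
- exact: proj_connection_field.
- move=> X X' Y Y' fX fX' fY fY' XX' YY' p Mp; rewrite /proj_connection -XX'//.
  congr tproj; apply: tderive_ext => //; first by case: fY.
  exact: vector_field_tangent.
- move=> X X' Y fX fX' [sY _] p Mp; rewrite /proj_connection tderive_dirD ?tprojD//;
    exact: vector_field_tangent.
- move=> f X Y sf fX [sY _] p Mp; rewrite /proj_connection tderive_dirZ ?tprojZ//;
    exact: vector_field_tangent.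
- move=> X Y Y' fX [sY _] [sY' _] p Mp; rewrite /proj_connection tderiveD ?tprojD//;
    exact: vector_field_tangent.
- move=> f X Y sf fX fY p Mp; rewrite /proj_connection tderive_scale//.
  + by rewrite tprojD !tprojZ (tangent_id Mp)//; exact: vector_field_tangent.
  + by case: fY.
  + exact: vector_field_tangent.
- move=> X Y fX fY p Mp; rewrite /proj_connection /lie_bracket.
  rewrite -tprojB; apply: tproj_id; first by case: Mp.
  have [_] := tderive_field fY Mp (vector_field_tangent fX Mp).
  have [_] := tderive_field fX Mp (vector_field_tangent fY Mp).
  move: (tderive M X p (Y p)) (tderive M Y p (X p)) (X p) (Y p) => B A x y eB eA.
  exact: tangent_eq_sub eB eA.
- move=> X Y Z fX fY fZ p Mp.
  have tX := vector_field_tangent fX Mp; have tY := vector_field_tangent fY Mp.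
  have tZ := vector_field_tangent fZ Mp.
  rewrite (tderive_metric fY fZ Mp tX) !SpGr_metricE//; last 2 first.
  + exact: (vector_field_tangent (proj_connection_field fX fZ)).
  + exact: (vector_field_tangent (proj_connection_field fX fY)).
  rewrite /proj_connection (mxtrace_tprojr _ Mp tY) -mulrDr mxtrace_mulC.
  by rewrite [in RHS]mxtrace_mulC (mxtrace_tprojr _ Mp tZ).
Qed.

(** The action of sp on SpGr by infinitesimal conjugation; these fields take every
tangent vector as a value. *)
Definition sp_field (A : Mat) : Mat -> Mat := mxcomm A.

Lemma sp_field_vector_field A : sp A -> vector_field M T (sp_field A).
Proof.
move=> hA; split=> [p Mp|p Mp]; last by exists A.
exists setT, (sp_field A); split=> //; first exact: openT.
move=> i; apply: Ck_on_mxcomm; [exact: openT|exact: Ck_on_cst|exact: Ck_on_id].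
Qed.

(** For a(X, Y, Z) = h(nabla_X Y - nabla'_X Y, Z), metricity makes [a] skew in Y, Z and
torsion-freeness makes it symmetric in X, Y. Six alternating exchanges give a = - a. *)
Lemma levi_civita_unique nabla nabla' X Y p :
  levi_civita M T h nabla -> levi_civita M T h nabla' ->
  vector_field M T X -> vector_field M T Y -> M p -> nabla X Y p = nabla' X Y p.
Proof.
move=> LC LC' fX fY Mp.
have fN := connection_field (levi_civita_connection LC).
have fN' := connection_field (levi_civita_connection LC').
have tan := vector_field_tangent.
pose a X Y Z := \tr (nabla X Y p *m Z p) - \tr (nabla' X Y p *m Z p).
have a_skew U V W : vector_field M T U -> vector_field M T V ->
    vector_field M T W ->
    a U V W = - a U W V.
  move=> fU fV fW.
  have := levi_civita_metric LC fU fV fW Mp.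
  rewrite (levi_civita_metric LC' fU fV fW Mp) !SpGr_metricE//; try exact: tan;
    try exact: (tan _ p (fN _ _ _ _)); try exact: (tan _ p (fN' _ _ _ _)).
  rewrite ![\tr (V p *m _)]mxtrace_mulC /a; lra.
have a_sym U V W : vector_field M T U -> vector_field M T V ->
    a U V W = a V U W.
  move=> fU fV.
  have := levi_civita_torsion_free LC fU fV Mp.
  rewrite -(levi_civita_torsion_free LC' fU fV Mp) => e.
  have : \tr ((nabla U V p - nabla V U p) *m W p) =
         \tr ((nabla' U V p - nabla' V U p) *m W p) by rewrite e.
  rewrite !mulmxBl !linearB/= /a; lra.
apply/eqP; rewrite -subr_eq0; apply/eqP.
apply: (metric_nondegenerate Mp).
  by apply: tangentB;
    [exact: (tan _ p (fN _ _ _ _))|exact: (tan _ p (fN' _ _ _ _))].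
move=> w Tw; have [A hA wE] := Tw.
rewrite SpGr_metricE//; last first.
  by apply: tangentB;
    [exact: (tan _ p (fN _ _ _ _))|exact: (tan _ p (fN' _ _ _ _))].
have fZ := sp_field_vector_field hA; rewrite -wE -/(sp_field A p).
rewrite mulmxBl linearB/= -/(a X Y (sp_field A)).
(* the tangent vector w is the value at p of the field [sp_field A] *)
suff : a X Y (sp_field A) = - a X Y (sp_field A) by lra.
rewrite {1}a_skew// a_sym// a_skew// opprK a_sym//.
by rewrite a_skew// a_sym.
Qed.

End LeviCivita.

(** * Covariant derivatives along curves, and geodesics *)

Section CovariantDerivative.
Context {R : realType} {n k : nat}.
Local Notation Mat := 'M[R]_(n + n).
Local Notation M := (@SpGr R n k).
Local Notation T := (@SpGr_tangent R n).
Local Notation h := (@SpGr_metric R n k).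
Implicit Types (p v : Mat) (I : set R) (g Z : R -> Mat).

Definition proj_covariant g Z (t : R) : Mat := tproj (g t) (derive1 Z t).

Lemma derive1_sym I Z t : open I -> smooth_on (V := R^o) I Z -> I t ->
  (forall s, I s -> sympinv (Z s) = Z s) ->
  sympinv (derive1 Z t) = derive1 Z t.
Proof.
move=> oI sZ It symZ; have dZ := smooth_is_derive sZ It.
have [_ <-] := is_derive_sympinv dZ; rewrite derive1E.
apply: near_eq_derive; apply: filterS (open_nbhs_nbhs (conj oI It)) => s Is.
exact: symZ.
Qed.

Lemma derive1_curve_tangent I g t : open I -> smooth_curve M I g -> I t ->
  T (g t) (derive1 g t).
Proof.
move=> oI [sg Mg] It; apply/(tangentP _ (Mg t It)); split.
  by apply: derive1_sym oI sg It _ => s /Mg[].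
have dg := smooth_is_derive sg It.
have [_ <-] := is_derive_mulmx dg dg; rewrite [RHS]derive1E.
apply: near_eq_derive; apply: filterS (open_nbhs_nbhs (conj oI It)) => s Is.
by have [-> _ _] := Mg s Is.
Qed.

(** For the restriction of a field [Y] to the curve, the chain rule identifies the
derivative of s |-> Y (g s) with the derivative of an extension of [Y] along g'. *)
Lemma proj_covariant_along I g : open I -> smooth_curve M I g ->
  covariant_derivative_along M T (@proj_connection R n k) I g (proj_covariant g).
Proof.
move=> oI cg; have [sg Mg] := cg; split.
- move=> Z [sZ tZ]; split=> [i|t It].
    have sZ' := Ck_derive1 (sZ i.+1).
    apply: (Ck_on_mxcomm oI _ (sg i)); exact: (Ck_on_mxcomm oI _ (sg i)).
  apply: (tproj_tangent (Mg t It)); apply: derive1_sym oI sZ It _ => s Is.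
  by have [] := (tangentP _ (Mg s Is)).1 (tZ s Is).
- move=> Z Z' _ _ ZZ' t It; rewrite /proj_covariant !derive1E; congr tproj.
  apply: near_eq_derive; apply: filterS (open_nbhs_nbhs (conj oI It)) => s Is.
  exact: ZZ'.
- move=> Z Z' [sZ _] [sZ' _] t It; rewrite /proj_covariant -tprojD; congr tproj.
  have [_ <-] := is_deriveD (smooth_is_derive sZ It) (smooth_is_derive sZ' It).
  by rewrite derive1E.
- move=> f Z sf [sZ tZ] t It; rewrite /proj_covariant.
  have df := smooth_is_derive sf It; have dZ := smooth_is_derive sZ It.
  have [_] := is_derive_scale df dZ; rewrite -derive1E => ->.
  by rewrite tprojD !tprojZ (tangent_id (Mg t It))//; exact: tZ.
- move=> X Y fX fY t It Xg; rewrite /proj_covariant /proj_connection.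
  congr tproj; have Mgt := Mg t It.
  have [sY tY] := fY; have [ O [F eF]] := sY _ Mgt.
  have [oO Op sF fF] := eF.
  have tX := vector_field_tangent fX Mgt.
  rewrite (tderiveE Mgt tX eF) Xg.
  have dg := smooth_is_derive sg It.
  have [_ <-] := is_derive_curve dg (local_extension_Ck eF Op).
  rewrite derive1E; apply: near_eq_derive.
  have cgt : g @ t --> g t.
    apply: differentiable_continuous; apply/derivable1_diffP; by case: dg.
  have n1 : \forall s \near t, O (g s) by apply: cgt; exact: open_nbhs_nbhs.
  have n2 : \forall s \near t, I s by exact: open_nbhs_nbhs.
  by apply: filterS2 n1 n2 => s Os Is /=; apply: fF => //; exact: Mg.
Qed.

Section SumsAlongCurve.
Context (nabla : (Mat -> Mat) -> (Mat -> Mat) -> (Mat -> Mat)).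
Context (I : set R) (g : R -> Mat) (D : (R -> Mat) -> (R -> Mat)).
Context (oI : open I) (cD : covariant_derivative_along M T nabla I g D).

Lemma field_along0 : field_along T I g (fun=> 0).
Proof.
split=> [i|t It]; first exact: Ck_on_cst.
by exists 0; rewrite /sp/= /mxcomm ?mul0mx ?mulmx0 ?subrr//;
  rewrite /sympinv trmx0 mulmx0 mul0mx oppr0.
Qed.

Lemma field_along_sum (J : Type) (r : seq J) (Z : J -> R -> Mat) :
  (forall j, field_along T I g (Z j)) ->
  field_along T I g (fun s => \sum_(j <- r) Z j s).
Proof.
move=> fZ; split=> [i|t It].
  by apply: Ck_on_sum => // j; have [+ _] := fZ j; exact.
elim/big_rec: _ => [|j x _ tx]; first by have [_ /(_ t It)] := field_along0.
by apply: tangentD => //; have [_ /(_ t It)] := fZ j.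
Qed.

(** The empty sum is the zero field, which is handled by the Leibniz rule with factor 0. *)
Lemma covariant_sum (J : Type) (r : seq J) (Z : J -> R -> Mat) t :
  (forall j, field_along T I g (Z j)) -> I t ->
  D (fun s => \sum_(j <- r) Z j s) t = \sum_(j <- r) D (Z j) t.
Proof.
move=> fZ It; elim: r => [|j r IH].
  rewrite big_nil.
  have fz : field_along T I g (fun s => (0 : R) *: (0 : Mat)).
    by rewrite scaler0; exact: field_along0.
  rewrite -(covariant_ext cD fz (field_along_sum [::] fZ) _ It); last first.
    by move=> s _; rewrite big_nil scaler0.
  have := covariant_leibniz cD (f := cst 0) _ field_along0 It.
  move=> ->; first by rewrite derive1_cst !scale0r addr0.
  by move=> i; exact: Ck_on_cst.
rewrite big_cons -IH.
have fr := field_along_sum r fZ.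
rewrite -(covariant_D cD (fZ j) fr It).
have consE : (fun s => \sum_(l <- j :: r) Z l s) =
    (fun s => Z j s + \sum_(l <- r) Z l s).
  by apply/funext => s; rewrite big_cons.
by rewrite consE.
Qed.

End SumsAlongCurve.

Definition skew_part (A : Mat) : Mat := 2^-1 *: (A - sympinv A).

Lemma skew_part_sp A : sp (skew_part A).
Proof. by rewrite /sp/= /skew_part sympinvZ sympinvB sympinvK -scalerN opprB. Qed.

Lemma skew_part_id A : sp A -> skew_part A = A.
Proof.
rewrite /sp/= /skew_part => ->; rewrite opprK scalerDr -scalerDl.
by rewrite (_ : 2^-1 + 2^-1 = 1) ?scale1r//; lra.
Qed.

Lemma skew_partD A B : skew_part (A + B) = skew_part A + skew_part B.
Proof. by rewrite /skew_part sympinvD; mxabel. Qed.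

Lemma skew_partZ a A : skew_part (a *: A) = a *: skew_part A.
Proof. by rewrite /skew_part sympinvZ; mxabel. Qed.

(** Globally defined fields that together span every tangent space. They are indexed by
matrix entries and hence redundant, which spares the choice of a basis of sp. *)
Definition frame_field i j : Mat -> Mat := sp_field (skew_part (delta_mx i j)).

Lemma frame_field_vector i j : vector_field M T (frame_field i j).
Proof. exact: sp_field_vector_field (skew_part_sp _). Qed.

(** The tangent vector is [W, p] with W = [v, p] in sp; expand [W] on the elementary
matrices and take skew parts. *)
Lemma frame_decomp p v : M p -> T p v ->
  v = \sum_i \sum_j mxcomm v p i j *: frame_field i j p.
Proof.
move=> Mp Tv; have [pp _ ps] := Mp; have [vs vp] := (tangentP _ Mp).1 Tv.
have Asp : sp (mxcomm v p) by exact: sp_mxcomm.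
rewrite -[LHS](tproj_id pp vp) /tproj -{1}(skew_part_id Asp).
set A := mxcomm v p.
pose L (B : Mat) := mxcomm (skew_part B) p.
have LD B C : L (B + C) = L B + L C.
  by rewrite /L skew_partD /mxcomm mulmxDl mulmxDr opprD addrACA.
have LZ a B : L (a *: B) = a *: L B by rewrite /L skew_partZ mxcommZl.
have L0 : L 0 = 0 by have := LZ 0 0; rewrite !scale0r.
rewrite -/(L A) [in LHS](matrix_sum_delta A) (big_morph L LD L0).
apply: eq_bigr => i _; rewrite (big_morph L LD L0).
by apply: eq_bigr => j _; rewrite LZ.
Qed.

(** Expand [Z] over the fields [frame_field]. The Leibniz rule leaves covariant
derivatives of restrictions of these fields, which are given by the connections,
and these agree. *)
Lemma covariant_unique nabla nabla' I g D D' Z t :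
  open I -> smooth_curve M I g ->
  levi_civita M T h nabla -> levi_civita M T h nabla' ->
  covariant_derivative_along M T nabla I g D ->
  covariant_derivative_along M T nabla' I g D' ->
  field_along T I g Z -> I t -> D Z t = D' Z t.
Proof.
move=> oI cg LC LC' cD cD' fZ It; have [sg Mg] := cg; have [sZ tZ] := fZ.
pose a i j s := mxcomm (Z s) (g s) i j.
have sa i j : smooth_on (V := R^o) I (a i j : R -> R^o).
  move=> l; have /(Ck_on_mxP _ _ oI)/(_ i j) := Ck_on_mxcomm oI (sZ l) (sg l).
  by [].
have fF i j : field_along T I g (fun s => frame_field i j (g s)).
  split=> [l|s Is].
    by apply: (Ck_on_mxcomm oI _ (sg l)); exact: Ck_on_cst.
  exact: vector_field_tangent (frame_field_vector i j) (Mg s Is).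
have faF i j : field_along T I g (fun s => a i j s *: frame_field i j (g s)).
  have [sF tF] := fF i j; split=> [l|s Is].
    exact: Ck_on_scale oI (sa i j l) (sF l).
  by apply: tangentZ; exact: tF.
have fs := field_along_sum oI (index_enum _)
  (fun i => field_along_sum oI (index_enum _) (faF i)).
have Zs s : I s -> Z s = \sum_i \sum_j a i j s *: frame_field i j (g s).
  by move=> Is; exact: frame_decomp (Mg s Is) (tZ s Is).
rewrite (covariant_ext cD fZ fs Zs It) (covariant_ext cD' fZ fs Zs It).
have fsi i := field_along_sum oI (index_enum _) (faF i).
rewrite (covariant_sum oI cD _ fsi It) (covariant_sum oI cD' _ fsi It).
apply: eq_bigr => i _.
rewrite (covariant_sum oI cD _ (faF i) It) (covariant_sum oI cD' _ (faF i) It).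
apply: eq_bigr => j _.
rewrite (covariant_leibniz cD (sa i j) (fF i j) It).
rewrite (covariant_leibniz cD' (sa i j) (fF i j) It).
congr (_ + _ *: _).
have [A hA vE] := derive1_curve_tangent oI cg It.
have fX := sp_field_vector_field (k := k) hA.
have fY := frame_field_vector i j.
rewrite (covariant_restrict cD fX fY It vE) (covariant_restrict cD' fX fY It vE).
exact: levi_civita_unique LC LC' fX fY (Mg t It).
Qed.

(** By uniqueness, the connection and covariant derivative hidden in the definition may be
taken to be the projected ambient derivatives. *)
Lemma geodesicP I g : is_geodesic M T h I g <->
  [/\ open I, is_interval I, smooth_curve M I g &
      forall t, I t -> tproj (g t) (derive1 (derive1 g) t) = 0].
Proof.
split=> [[oI iI cg fg [nabla [D [LC cD D0]]]]|[oI iI cg g0]].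
  split=> // t It; rewrite -(D0 t It).
  rewrite (covariant_unique oI cg LC (@proj_connection_LC R n k) cD
    (proj_covariant_along oI cg) fg It).
  by [].
split=> //.
  split=> [i|t It]; first by have [sg _] := cg; exact: Ck_derive1 (sg i.+1).
  exact: derive1_curve_tangent oI cg It.
exists (@proj_connection R n k), (proj_covariant g).
split; [exact: proj_connection_LC|exact: proj_covariant_along|exact: g0].
Qed.

(** Conjugation by exp(tW) fixes [W], so [W] exchanges image and kernel of every point of
the curve, and the second derivative [W, [W, c]] commutes with [c]. *)
Lemma sp_orbit_geodesic p v : M p -> T p v ->
  is_geodesic M T h setT (sp_orbit (mxcomm v p) p).
Proof.
move=> Mp Tv; have [Wsp Wp] := tangent_mxcomm_anti Mp Tv.
set W := mxcomm v p in Wsp Wp *; set c := sp_orbit W p.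
have Mc t : M (c t) by exact: sp_orbit_SpGr.
have dc : derive1 c = fun t => mxcomm W (c t).
  by apply/funext => t; rewrite derive1E; have [_] := is_derive_sp_orbit W p t.
apply/geodesicP; split.
- exact: openT.
- by move=> ? ? ? ? ? ?.
- by split=> // i; exact: smooth_sp_orbit.
move=> t _; have [cc _ _] := Mc t.
have Wc : W *m c t + c t *m W = W.
  rewrite /c /sp_orbit !mulmxA expm_commZ.
  rewrite -[X in _ + X]mulmxA -(expm_commZ W (- t)) !mulmxA.
  rewrite -mulmxDl -!(mulmxA (expm (t *: W))) -mulmxDr Wp.
  by rewrite -expm_commZ -mulmxA expmV_r mulmx1.
have -> : derive1 (derive1 c) t = mxcomm W (mxcomm W (c t)).
  rewrite dc derive1E.
  have := is_derive_mxcomm (is_derive_cst W t 1) (is_derive_sp_orbit W p t).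
  by case=> _ ->; rewrite -/c /mxcomm mul0mx mulmx0 subrr add0r.
apply: tproj_comm0 => //.
exact: mxcomm_mxcomm_comm.
Qed.

(** The geodesic equation conserves [g', g]; this turns it into a linear equation with
constant coefficients, which the exponential integrates. *)
Lemma geodesic_sp_orbit I g t : is_geodesic M T h I g -> I 0 -> I t ->
  g t = sp_orbit (mxcomm (derive1 g 0) (g 0)) (g 0) t.
Proof.
move=> /geodesicP[oI iI cg gE] I0 It; have [sg Mg] := cg.
have sg' : smooth_on (V := R^o) I (derive1 g).
  by move=> i; exact: Ck_derive1 (sg i.+1).
pose L s := mxcomm (derive1 g s) (g s).
have dL s : I s -> is_derive s 1 L 0.
  move=> Is.
  have h := is_derive_mxcomm (smooth_is_derive sg' Is) (smooth_is_derive sg Is).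
  apply: is_derive_eq h _; have [cc _ _] := Mg s Is.
  by rewrite /mxcomm (tproj_eq0_comm cc (gE s Is)) !subrr addr0.
have LE s : I s -> L s = L 0.
  by move=> Is; exact: is_derive0_mx_cst iI dL _ _ Is I0.
rewrite -/(L 0); set W := L 0.
have dgW s : I s -> is_derive s 1 g (mxcomm W (g s)).
  move=> Is; have dg := smooth_is_derive sg Is; apply: is_derive_eq dg _.
  rewrite -{1}(tangent_id (Mg s Is) (derive1_curve_tangent oI cg Is)).
  by rewrite /W -(LE s Is).
(* variation of constants: N is constant along solutions of g' = [W, g] *)
pose N s := expm (- s *: W) *m g s *m expm (s *: W).
have dN s : I s -> is_derive s 1 N 0.
  move=> Is; have h1 := is_derive_mulmx (is_derive_expmN W s) (dgW s Is).
  have h2 := is_derive_mulmx h1 (is_derive_expm W s).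
  apply: is_derive_eq h2 _.
  rewrite (expm_commZ W (- s)) /mxcomm !mx_distr; mxabel.
have : N t = g 0.
  rewrite (is_derive0_mx_cst iI dN It I0) /N oppr0 scale0r expm0.
  by rewrite mul1mx mulmx1.
rewrite /sp_orbit => <-; rewrite /N !mulmxA expmV_r mul1mx.
by rewrite -mulmxA expmV_r mulmx1.
Qed.

End CovariantDerivative.

(** * The geodesics of the symplectic Grassmannian *)

(** Here U U^+ Gamma U U^+ = 0, so the factors 1/2 in the metric of SpSt drop out. *)
Lemma Omega_tilde_hor (R : realType) (n k : nat) (Gamma : 'M[R]_(n + n))
    (U : 'M[R]_(n + n, k + k)) (t : R) :
  @SpGr R n k (rho U) -> SpGr_tangent (rho U) Gamma ->
  Omega_tilde U (t *: hor U Gamma) = t *: mxcomm Gamma (rho U).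
Proof.
move=> hP hG; have [PP _ _] := hP; have [Gs GP] := (tangentP _ hP).1 hG.
have PGP := tangent_corner0 PP GP.
rewrite /Omega_tilde /hor sympinvZ sympinvM Gs -/(rho U).
have -> : (1%:M - 2^-1 *: rho U) *m (t *: (Gamma *m U)) *m sympinv U =
    t *: ((1%:M - 2^-1 *: rho U) *m (Gamma *m rho U)).
  by rewrite -scalemxAr -scalemxAl /rho !mulmxA.
have -> : U *m (t *: (sympinv U *m Gamma)) *m (1%:M - 2^-1 *: rho U) =
    t *: ((rho U *m Gamma) *m (1%:M - 2^-1 *: rho U)).
  by rewrite -scalemxAr -scalemxAl /rho !mulmxA.
rewrite -scalerBr /mxcomm; congr (_ *: _).
move: (rho U) PGP => P PGP.
rewrite mulmxBl mulmxBr mul1mx mulmx1 -scalemxAl -scalemxAr mulmxA PGP.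
by rewrite scaler0 !subr0.
Qed.

Lemma rho_ExpSpSt (R : realType) (n k : nat) (Gamma : 'M[R]_(n + n))
    (U : 'M[R]_(n + n, k + k)) (t : R) :
  @SpGr R n k (rho U) -> SpGr_tangent (rho U) Gamma ->
  rho (ExpSpSt U (t *: hor U Gamma)) =
  sp_orbit (mxcomm Gamma (rho U)) (rho U) t.
Proof.
move=> hP hG; have [Wsp _] := tangent_mxcomm_anti hP hG.
rewrite /ExpSpSt (Omega_tilde_hor _ hP hG); set W := mxcomm _ _ in Wsp *.
rewrite {1}/rho sympinvM sympinv_expm sympinvZ Wsp scalerN -scaleNr.
by rewrite /sp_orbit /rho !mulmxA.
Qed.

Unset Implicit Arguments.

Theorem proposition4p6 (R : realType) (n k : nat)
    (k_gt0 : (0 < k)%N) (le_kn : (k <= n)%N)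
    (P Gamma : 'M[R]_(n + n)) (U : 'M[R]_(n + n, k + k))
    (hP : @SpGr R n k P) (hGamma : SpGr_tangent P Gamma)
    (hU : SpSt U) (hUP : rho U = P) :
  let geodesic := is_geodesic (@SpGr R n k) (@SpGr_tangent R n)
                    (@SpGr_metric R n k) in
  let ExpSpGr := fun t : R => rho (ExpSpSt U (t *: hor U Gamma)) in
  [/\ (* it is a geodesic, defined for all times, with the given initial data *)
      geodesic setT ExpSpGr /\ ExpSpGr 0 = P /\ derive1 ExpSpGr 0 = Gamma,
      (* and the only one *)
      forall (I : set R) (g : R -> 'M[R]_(n + n)),
        geodesic I g -> I 0 -> g 0 = P -> derive1 g 0 = Gamma ->
        forall t, I t -> g t = ExpSpGr t
    & forall t : R,
        ExpSpGr t =
        expm (t *: mxcomm Gamma P) *m P *m expm (- t *: mxcomm Gamma P)].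
Proof.
subst P.
have -> : (fun t : R => rho (ExpSpSt U (t *: hor U Gamma))) =
    sp_orbit (mxcomm Gamma (rho U)) (rho U).
  by apply/funext => t; exact: rho_ExpSpSt.
move=> geodesic ExpSpGr; split=> [|I g hg I0 g0 g'0 t It|//].
  split; first exact: sp_orbit_geodesic.
  split; first exact: sp_orbit0.
  rewrite derive1E.
  have [_ ->] := is_derive_sp_orbit (mxcomm Gamma (rho U)) (rho U) 0.
  by rewrite sp_orbit0; exact: tangent_id hP hGamma.
by rewrite (geodesic_sp_orbit hg I0 It) g'0 g0.
Qed.
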